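(* Suppose that $b$ satisfies assumptions (A1)–(A3) of the context. Then the SDE $$Y_t = Y_0 + \int_0^t b(s,Y_s)\,ds + Z_t$$ has a unique local solution in the following sense: there exists a continuous process $Y=\{Y_t,\ t\in[0,T]\}$ such that $$Y_t = Y_0 + \int_0^t b(s,Y_s)\,ds + Z_t \qquad \forall t\in[0,\tau_0],$$ with $$\tau_0 := \sup\{t\in[0,T] : \forall s\in[0,t):\ Y_s>\varphi(s)\} = \inf\{t\in[0,T] : Y_t=\varphi(t)\}\wedge T .$$ Furthermore, if $\tilde Y$ is another continuous process satisfying the same equation on any interval $[0,t]\subset[0,\tilde\tau_0)$, where $$\tilde\tau_0 := \sup\{s\in[0,T] : \forall u\in[0,s):\ \tilde Y_u>\varphi(u)\},$$ then $\tau_0=\tilde\tau_0$ and $\tilde Y_t=Y_t$ for all $t\in[0,\tau_0]$.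
   Context: Fix $T\in(0,\infty)$ and $\lambda\in(0,1)$. Let $\varphi:[0,T]\to\mathbb R$ be $\lambda$-Hölder continuous. For $a\ge 0$ let $\mathcal D_a := \{(t,y) : t\in[0,T],\ y\in(\varphi(t)+a,\infty)\}$. The initial value $Y_0$ is a deterministic constant with $Y_0>\varphi(0)$. The noise $Z=\{Z_t,\ t\in[0,T]\}$ is a stochastic process such that $Z_0=0$ a.s. and there is a random variable $\Lambda=\Lambda(\omega)\in(0,\infty)$ with $|Z_t-Z_s|\le\Lambda|t-s|^\lambda$ for all $t,s\in[0,T]$. All equations are understood pathwise. Assumptions on the drift $b$: (A1) $b:\mathcal D_0\to\mathbb R$ is continuous. (A2) For any $\varepsilon>0$ there is a constant $c_\varepsilon>0$ such that $|b(t,y_1)-b(t,y_2)|\le c_\varepsilon|y_1-y_2|$ for all $(t,y_1),(t,y_2)\in\mathcal D_\varepsilon$. (A3) There are positive constants $y_*$, $c$, $\gamma$ such that $b(t,y)\ge \frac{c}{(y-\varphi(t))^\gamma}$ for all $(t,y)\in\mathcal D_0\setminus\mathcal D_{y_*}$. At $t=\tau_0$ the integral $\int_0^{\tau_0} b(s,Y_s)\,ds$ is taken over $s\in[0,\tau_0)$, where $Y_s>\varphi(s)$. *)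

(* Defs.v *)
From HB Require Import structures.
From mathcomp Require Import all_boot all_order all_algebra.
From mathcomp Require Import all_classical all_reals all_analysis.

Set Implicit Arguments.
Unset Strict Implicit.
Unset Printing Implicit Defensive.

Import Order.TTheory GRing.Theory Num.Theory.
Import numFieldNormedType.Exports.

Local Open Scope classical_set_scope.
Local Open Scope ring_scope.

(* Functions of time have type R -> A and drifts type R -> R -> R; only their
   values for times in [0, T], resp. on the domain D_0, are ever used. *)

Definition holder_on (R : realType) (T lambda C : R) (f : R -> R) : Prop :=
  forall s t : R, 0 <= s <= T -> 0 <= t <= T ->
    `|f t - f s| <= C * `|t - s| `^ lambda.

Definition domainD (R : realType) (T : R) (phi : R -> R) (a : R) :
    set (R * R) :=
  [set p | 0 <= p.1 <= T /\ phi p.1 + a < p.2].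

Definition drift_continuous (R : realType) (T : R) (phi : R -> R)
    (b : R -> R -> R) : Prop :=
  {within domainD T phi 0, continuous (fun p : R * R => b p.1 p.2)}.

Definition drift_lipschitz (R : realType) (T : R) (phi : R -> R)
    (b : R -> R -> R) : Prop :=
  forall eps : R, 0 < eps -> exists2 c : R, 0 < c &
    forall t y1 y2 : R,
      domainD T phi eps (t, y1) -> domainD T phi eps (t, y2) ->
      `|b t y1 - b t y2| <= c * `|y1 - y2|.

Definition drift_repulsive (R : realType) (T : R) (phi : R -> R)
    (b : R -> R -> R) : Prop :=
  exists ystar c gamma : R, [/\ 0 < ystar, 0 < c, 0 < gamma &
    forall t y : R, (domainD T phi 0 `\` domainD T phi ystar) (t, y) ->
      c / (y - phi t) `^ gamma <= b t y].

Definition continuous_process (R : realType) (d : measure_display)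
    (Omega : measurableType d) (P : probability Omega R) (T : R)
    (X : R -> {RV P >-> R}) : Prop :=
  forall w : Omega, {within `[0, T], continuous (fun t : R => X t w)}.

(* Z_0 = 0 a.s., and every path is lambda-Hoelder on [0, T] with a random
   constant. *)
Definition holder_noise (R : realType) (d : measure_display)
    (Omega : measurableType d) (P : probability Omega R) (T lambda : R)
    (Z : R -> {RV P >-> R}) : Prop :=
  {ae P, forall w, Z 0 w = 0} /\
  exists Lambda : {RV P >-> R}, forall w : Omega,
    0 < Lambda w /\ holder_on T lambda (Lambda w) (fun t => Z t w).

(* The pathwise equation y_t = Y0 + int_0^t b(s, y_s) ds + z_t at time t.
   Integrability is required explicitly because the real-valued integral
   of a non-integrable function has a default value.  The integral is over
   [0, t[, as at t = tau_0 the drift need not be defined at (t, y_t). *)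
Definition equation_at (R : realType) (b : R -> R -> R) (Y0 : R)
    (z y : R -> R) (t : R) : Prop :=
  (@lebesgue_measure R).-integrable `[0, t[ (fun s => (b s (y s))%:E) /\
  y t = Y0 + \int[@lebesgue_measure R]_(s in `[0, t[) b s (y s) + z t.

(* For 0 <= T this set contains 0 and is bounded above by T. *)
Definition exit_time (R : realType) (T : R) (phi y : R -> R) : R :=
  sup [set t | 0 <= t <= T /\ forall s : R, 0 <= s < t -> phi s < y s].

(* Extended-real infimum: it is +oo when y never meets phi on [0, T]. *)
Definition hitting_time (R : realType) (T : R) (phi y : R -> R) : \bar R :=
  ereal_inf [set t%:E | t in [set t : R | 0 <= t <= T /\ y t = phi t]].

(* Main.v *)
Require Import Defs.
From HB Require Import structures.
From mathcomp Require Import all_boot all_order all_algebra.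
From mathcomp Require Import all_classical all_reals all_analysis.
From mathcomp Require Import measurable_realfun.
From mathcomp Require Import ring lra.
Set Implicit Arguments.
Unset Strict Implicit.
Unset Printing Implicit Defensive.
Import Order.TTheory GRing.Theory Num.Theory.
Import numFieldNormedType.Exports.
Local Open Scope classical_set_scope.
Local Open Scope ring_scope.

(** The statement is pathwise once the forcing path
    [g t = Y0 + (Z t - Z 0)] is fixed; the randomness matters only for the
    measurability of the solution, and the null set where [Z 0] is nonzero only
    for passing from [g] to the equation itself.

    Existence. Freeze the drift below height [n.+1%:R^-1] above [phi]. By (A1)
    and (A2) the frozen drift is continuous and globally Lipschitz in space, so
    Picard iteration, which contracts in an exponentially weighted norm, gives a
    solution [approx g n] on all of [[0, T]]. As long as it stays above the frozen
    zone it solves the original equation, and by uniqueness for Lipschitz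
    equations the paths for larger [n] agree with it there. Their common
    continuation is the solution [sol g], extended by [phi] after its death.
    As each [approx g n] is defined up to [T], no explosion can occur: the solution
    dies at [t] only if its gap to [phi] becomes arbitrarily small before [t]
    ([gap_gets_small]).

    The repulsion (A3) enters through its sign alone. Near [phi] the drift is
    nonnegative, so the gap can decrease only through the continuous path
    [g - phi]; it cannot oscillate between two heights as [t] approaches the death
    time and must tend to [0] ([gap_vanishes]). This makes the extended path
    continuous. The same sign makes the drift integrable up to the death
    time, by monotone convergence, which gives the equation at that time
    ([sol_solves_at_death]).

    Uniqueness. Any solution that is strictly above [phi] on a compact interval is
    bounded away from it there, hence coincides with some [approx g n]
    ([capture]). So two solutions agree until one of them exits, and
    continuity forces the exit times to coincide ([sol_unique]).

    Measurability. Picard iterates are limits of Riemann sums, and survival up to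
    [t] is a countable intersection of events because it can be tested at rational
    times; the solution is a pointwise limit of the resulting random variables. *)

(** * Continuity on compact intervals *)

Section Continuity.
Context {R : realType}.
Implicit Types (f g : R -> R) (a b t T : R).

Lemma within_continuousP (A : set R) f :
  {within A, continuous f} <->
  (forall t (e : R), A t -> 0 < e ->
     exists2 d : R, 0 < d & forall s, A s -> `|s - t| < d -> `|f s - f t| < e).
Proof.
rewrite subspace_continuousP; split => [fc t e At e0|fc t At].
  have /cvgrPdist_lt/(_ _ e0) := fc t At.
  rewrite /within/= => /nbhs_ballP[d /= d0 dP]; exists d => // s As st.
  by rewrite distrC; apply: dP => //; rewrite /ball/= distrC.
apply/cvgrPdist_lt => e e0; have [d d0 dP] := fc t e At e0.
apply/nbhs_ballP; exists d => //= s; rewrite /ball/= => st As.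
by rewrite distrC; apply: dP => //; rewrite distrC.
Qed.

(** Precomposing with the projection onto [[0, T]] turns a path that is
    continuous on the time interval only into a continuous function on the whole
    line, so that no one-sided limits appear at the endpoints. *)
Definition clamp T t := Num.max 0 (Num.min t T).

Lemma clamp_id T t : 0 <= t <= T -> clamp T t = t.
Proof. by case/andP => t0 tT; rewrite /clamp min_l// max_r. Qed.

Lemma clamp_itv T t : 0 <= T -> 0 <= clamp T t <= T.
Proof. by move=> T0; rewrite /clamp le_max lexx/= ge_max T0/= ge_min lexx orbT. Qed.

Lemma clampK T t : 0 <= T -> clamp T (clamp T t) = clamp T t.
Proof. by move=> T0; rewrite clamp_id// clamp_itv. Qed.

Lemma continuous_clamp T : continuous (clamp T).
Proof.
move=> t; rewrite /clamp.
apply: (@continuous_max R R (cst 0) (fun t => Num.min t T) t).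
  exact: cst_continuous.
by apply: (@continuous_min R R id (cst T) t); [exact: cvg_id|exact: cst_continuous].
Qed.

Lemma continuous_comp_within {U V W : topologicalType} (A : set V)
    (h : V -> W) (k : U -> V) :
  {within A, continuous h} -> continuous k -> (forall x, A (k x)) ->
  continuous (h \o k).
Proof.
move=> /subspace_continuousP hc kc Ak x.
have H := hc _ (Ak x).
move=> B /H AB; have := kc x _ AB.
by apply: (@filterS _ (nbhs x)) => y; apply; exact: Ak.
Qed.

Lemma continuous_comp_clamp T f : 0 <= T ->
  {within `[0, T], continuous f} -> continuous (f \o clamp T).
Proof.
move=> T0 /continuous_comp_within; apply; first exact: continuous_clamp.
by move=> x /=; rewrite in_itv/= clamp_itv.
Qed.

Lemma bounded_on_segment f a b : a <= b -> {within `[a, b], continuous f} ->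
  exists2 M, 0 < M & forall t, a <= t <= b -> `|f t| <= M.
Proof.
move=> ab fc; have [c cab cM] := EVT_max ab fc.
have [c' c'ab c'M] := EVT_min ab fc.
exists (`|f c| + `|f c'| + 1) => [|t tab]; first by rewrite ltr_wpDl// addr_ge0.
have := cM t; have := c'M t; rewrite in_itv/= tab => /(_ isT) h1 /(_ isT) h2.
have [h3 h4] := (ler_norm (f c), ler_norm (- f c')).
by rewrite normrN in h4; rewrite ler_norml; apply/andP; split;
  have := normr_ge0 (f c); have := normr_ge0 (f c'); lra.
Qed.

Lemma holder_continuous T lambda C f : 0 < lambda -> holder_on T lambda C f ->
  {within `[0, T], continuous f}.
Proof.
move=> l0 fh; apply/within_continuousP => t e /=; rewrite in_itv/= => tT e0.
(* The constant of [holder_on] may be nonpositive, whence [`|C| + 1]. *)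
pose K := `|C| + 1; have K0 : 0 < K by rewrite ltr_wpDl.
have eK : 0 < e / K by rewrite divr_gt0.
exists ((e / K) `^ lambda^-1); first exact: powR_gt0.
move=> s; rewrite in_itv/= => sT std.
have [->|st] := eqVneq s t; first by rewrite subrr normr0.
apply: (le_lt_trans (fh t s tT sT)).
have h : `|s - t| `^ lambda < e / K.
  have := gt0_ltr_powR l0 _ _ std.
  rewrite -powRrM mulVf ?gt_eqF// powRr1 ?ltW//; apply; rewrite ?nnegrE//.
  exact: powR_ge0.
rewrite -(@divfK _ K _ e) ?gt_eqF// mulrC.
apply: (@le_lt_trans _ _ (`|s - t| `^ lambda * K)).
  rewrite ler_wpM2l ?powR_ge0//.
  by rewrite (le_trans (ler_norm C))// lerDl.
by rewrite ltr_pM2r.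
Qed.

(** The last time is the supremum of [f >= v], which is attained because that
    set is closed. *)
Lemma last_passage f a b v : a <= b -> {within `[a, b], continuous f} ->
  v <= f a -> f b < v ->
  exists2 r, a <= r < b & v <= f r /\ forall x, r < x <= b -> f x < v.
Proof.
move=> ab /within_continuousP fc va vb.
pose S := [set x | a <= x <= b /\ v <= f x].
have Sa : S a by split; rewrite ?lexx.
have Sub : ubound S b by move=> x [/andP[]].
have hS : has_sup S by split; [exists a|exists b].
have ar : a <= sup S by exact: ub_le_sup (ex_intro _ b Sub) _ Sa.
have rb : sup S <= b by exact: ge_sup (ex_intro _ a Sa) Sub.
have rab : `[a, b]%classic (sup S) by rewrite /= in_itv/= ar rb.
have vr : v <= f (sup S).
  rewrite leNgt; apply/negP => frv.
  have [d d0 dP] := fc _ (v - f (sup S)) rab (ltac:(by rewrite subr_gt0)).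
  have [x [xab vx] xS] := sup_adherent d0 hS.
  have xS' : x <= sup S by apply: ub_le_sup; [exists b|split].
  have /dP : `[a, b]%classic x by rewrite /= in_itv.
  rewrite ltr_norml ltr_norml => /(_ _)/andP[]; first by apply/andP; split; lra.
  by move=> _; lra.
exists (sup S).
  by rewrite ar lt_neqAle rb andbT; apply: contraTneq vr => ->; rewrite -ltNge.
split => // x /andP[rx xb]; rewrite ltNge; apply/negP => vx.
have : x <= sup S by apply: ub_le_sup; [exists b|split; rewrite // xb andbT; lra].
lra.
Qed.

End Continuity.

(** * Exit and hitting times of continuous paths *)

Section ExitTime.
Context {R : realType}.
Variables (T : R) (phi u : R -> R).
Hypothesis T_gt0 : 0 < T.
Hypothesis phi_cont : {within `[0, T], continuous phi}.
Hypothesis u_cont : {within `[0, T], continuous u}.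
Hypothesis u0 : phi 0 < u 0.
Let tau := exit_time T phi u.

(** Everything later used about the exit time: if the path is strictly above
    [phi] at the exit time, continuity would let it survive a bit longer unless
    time has run out; and a path starting strictly above [phi] has a positive
    exit time. *)
Lemma exit_timeP : [/\ 0 < tau <= T,
  forall s, 0 <= s < tau -> phi s < u s, phi tau <= u tau &
  u tau = phi tau \/ tau = T].
Proof.
have T0 := ltW T_gt0.
pose S := [set t | 0 <= t <= T /\ forall s : R, 0 <= s < t -> phi s < u s].
have S0 : S 0.
  by split; [rewrite lexx|move=> s /andP[s0 /(le_lt_trans s0)]; rewrite ltxx].
have ubS : ubound S T by move=> x [/andP[]].
have hS : has_sup S by split; [exists 0|exists T].
have tau0 : 0 <= tau by apply: ub_le_sup => //; exists T.
have tauT : tau <= T by apply: ge_sup => //; exists 0.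
have before s : 0 <= s < tau -> phi s < u s.
  move=> /andP[s0 st]; have d0 : 0 < tau - s by rewrite subr_gt0.
  have [x [_ xP] sx] := sup_adherent d0 hS.
  by apply: xP; rewrite s0/=; move: sx; rewrite -/(exit_time T phi u) -/tau; lra.
have hc : {within `[0, T], continuous (fun s => u s - phi s)}.
  by move=> x; apply: cvgB; [exact: u_cont|exact: phi_cont].
have tauI : `[0, T]%classic tau by rewrite /= in_itv/= tau0.
move/within_continuousP : hc => hc.
have ge : phi tau <= u tau.
  rewrite leNgt; apply/negP => neg.
  have tau_gt0 : 0 < tau.
    rewrite lt_neqAle tau0 andbT; apply: contraTneq neg => <-.
    by rewrite -leNgt ltW.
  have [d d0 dP] := hc tau (phi tau - u tau) tauI (ltac:(by rewrite subr_gt0)).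
  pose x := Num.max 0 (tau - d / 2).
  have xt : 0 <= x < tau by rewrite le_max lexx/= gt_max tau_gt0 gtrBl divr_gt0.
  have /andP[x0 xtau] := xt.
  have xd : tau - d / 2 <= x by rewrite le_max lexx orbT.
  have /ltr_normlP[_] : `|u x - phi x - (u tau - phi tau)| < phi tau - u tau.
    apply: dP; first by rewrite /= in_itv/= x0 (le_trans (ltW xtau)).
    by rewrite ltr0_norm ?subr_lt0//; lra.
  by have := before x xt; lra.
have alt : u tau = phi tau \/ tau = T.
  move: ge; rewrite le_eqVlt => /predU1P[->|pos]; [by left|right].
  apply/eqP; rewrite eq_le tauT/= leNgt; apply/negP => tauT'.
  have [d d0 dP] := hc tau (u tau - phi tau) tauI (ltac:(by rewrite subr_gt0)).
  pose x := Num.min T (tau + d / 2).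
  have xtau : tau < x by rewrite lt_min tauT' ltrDl divr_gt0.
  have xd : x <= tau + d / 2 by rewrite ge_min lexx orbT.
  have xT : x <= T by rewrite ge_min lexx.
  suff : x <= tau by rewrite leNgt xtau.
  apply: ub_le_sup; first by exists T.
  split; first by rewrite xT (le_trans tau0 (ltW xtau)).
  move=> s /andP[s0 sx]; have [st|ts] := ltP s tau; first by apply: before; rewrite s0.
  have /ltr_normlP[+ _] : `|u s - phi s - (u tau - phi tau)| < u tau - phi tau.
    apply: dP; first by rewrite /= in_itv/= s0 (le_trans (ltW sx)).
    by rewrite ger0_norm ?subr_ge0//; lra.
  lra.
split => //; rewrite tauT andbT lt_neqAle tau0 andbT; apply/eqP => t0.
by case: alt; rewrite -t0 => E; [move: u0; rewrite E ltxx|move: T_gt0; rewrite -E ltxx].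
Qed.

Lemma exit_time_hitting : tau%:E = Order.min (hitting_time T phi u) T%:E.
Proof.
have [/andP[tau0 tauT] before ge alt] := exit_timeP.
have low t : 0 <= t <= T -> u t = phi t -> tau <= t.
  move=> /andP[t0 tT] ut; rewrite leNgt; apply/negP => ttau.
  by have := before t; rewrite t0 ttau ut ltxx => /(_ isT).
have [E|ne] := pselect (u tau = phi tau).
  have -> : hitting_time T phi u = tau%:E.
    apply/eqP; rewrite eq_le; apply/andP; split.
      by apply: ereal_inf_lbound; exists tau => //=; rewrite (ltW tau0).
    by apply: le_ereal_inf_tmp => _ [t [tT ut] <-]; rewrite lee_fin low.
  by rewrite min_l// lee_fin.
have tauE : tau = T by case: alt.
rewrite min_r; first by rewrite tauE.
apply: le_ereal_inf_tmp => _ [t [tT ut] <-].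
by rewrite lee_fin -tauE low.
Qed.

End ExitTime.

(** * Integrals of paths *)

Section Integrals.
Context {R : realType}.
Notation mu := (@lebesgue_measure R).
Implicit Types (F G : R -> R) (s t a : R).

Lemma integrable_itv_sub F a s t u : a <= s -> t <= u ->
  mu.-integrable `[a, u[ (fun x => (F x)%:E) ->
  mu.-integrable `[s, t[ (fun x => (F x)%:E).
Proof.
move=> as_ tu; apply: integrableS => //.
by apply: subset_itv; rewrite bnd_simp.
Qed.

Lemma Rintegral_itv_cat F a s t : a <= s <= t ->
  mu.-integrable `[a, t[ (fun x => (F x)%:E) ->
  \int[mu]_(x in `[a, t[) F x =
    \int[mu]_(x in `[a, s[) F x + \int[mu]_(x in `[s, t[) F x.
Proof.
case/andP => as_ st iF.
have E : `[a, t[%classic = `[a, s[ `|` `[s, t[ :> set R.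
  by apply: itv_bndbnd_setU; rewrite bnd_simp.
rewrite [in LHS]E Rintegral_setU//=; first by rewrite -E.
apply/disj_setPS => x /= []; rewrite !in_itv/= => /andP[_ xs] /andP[sx _].
by move: (lt_le_trans xs sx); rewrite ltxx.
Qed.

Lemma continuous_integrable_itv F s t : continuous F ->
  mu.-integrable `[s, t[ (fun x => (F x)%:E).
Proof.
move=> Fc; apply: (@integrableS _ _ _ mu `[s, t]) => //.
  exact: subset_itv_co_cc.
apply: continuous_compact_integrable; first exact: segment_compact.
exact: continuous_subspaceT.
Qed.

Lemma Rintegral_expR a t : 0 < a -> 0 <= t ->
  \int[mu]_(x in `[0, t[) expR (a * x) = (expR (a * t) - 1) / a.
Proof.
move=> a0; rewrite le_eqVlt => /predU1P[<-|t0].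
  by rewrite set_itv_ge ?bnd_simp// Rintegral_set0 mulr0 expR0 subrr mul0r.
have ec : continuous (fun x : R => expR (a * x)).
  move=> x; apply: continuous_comp; last exact: continuous_expR.
  exact: mulrl_continuous.
rewrite Rintegral_itv_bndo_bndc; last exact: continuous_integrable_itv.
pose H x := expR (a * x) / a.
have dH (x : R) : is_derive x 1 H (expR (a * x)).
  have ax : is_derive x 1 ( *%R a) a by apply: is_derive_eq; exact: mulr1.
  have eax := @is_derive1_comp _ expR _ x _ _ (is_derive_expR _) ax.
  have -> : H = a^-1 \*: (expR \o *%R a) by apply/funext => y; exact: mulrC.
  by apply: is_derive_eq; rewrite /GRing.scale/= mulrCA mulVf ?mulr1// gt_eqF.
have Hc : continuous H.
  by move=> x; apply: differentiable_continuous; apply/derivable1_diffP; apply: ex_derive.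
rewrite /Rintegral (@continuous_FTC2 _ _ H 0 t)//.
- by rewrite /= /H mulr0 expR0 -mulrBl.
- exact: continuous_subspaceT.
- split; first by move=> x _; exact: ex_derive.
  + by apply: cvg_at_right_filter; exact: Hc.
  + by apply: cvg_at_left_filter; exact: Hc.
- by move=> x _; rewrite derive1E; exact: derive_val.
Qed.

(** The weight [expR (a * t)] is chosen because integrating it up to [t] gains a
    factor [a^-1]: with [a] twice a Lipschitz constant, integral operators become
    contractions of ratio one half. *)
Lemma Rintegral_dist_expR F G K a t : 0 < a -> 0 <= t -> 0 <= K ->
  mu.-integrable `[0, t[ (fun x => (F x)%:E) ->
  mu.-integrable `[0, t[ (fun x => (G x)%:E) ->
  (forall x, 0 <= x < t -> `|F x - G x| <= K * expR (a * x)) ->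
  `|\int[mu]_(x in `[0, t[) F x - \int[mu]_(x in `[0, t[) G x|
    <= K / a * expR (a * t).
Proof.
move=> a0 t0 K0 iF iG FG.
have ec : continuous (fun x : R => expR (a * x)).
  move=> x; apply: continuous_comp; last exact: continuous_expR.
  exact: mulrl_continuous.
have iE := continuous_integrable_itv 0 t ec.
have iFG : mu.-integrable `[0, t[ (fun x => (F x - G x)%:E).
  have := integrableB _ iF iG; apply; exact: measurable_itv.
rewrite -RintegralB//; apply: (le_trans (le_normr_Rintegral _ _)) => //.
apply: (@le_trans _ _ (\int[mu]_(x in `[0, t[) (K * expR (a * x)))).
  apply: le_Rintegral => //.
  - exact: (integrable_norm iFG).
  - exact: (integrableZl _ K iE).
rewrite RintegralZl// Rintegral_expR// mulrA mulrAC.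
by rewrite ler_wpM2l ?divr_ge0 ?(ltW a0)// gerBl.
Qed.

Lemma Rintegral_lip F M s t : s <= t ->
  mu.-integrable `[s, t[ (fun x => (F x)%:E) ->
  (forall x, s <= x < t -> `|F x| <= M) ->
  `|\int[mu]_(x in `[s, t[) F x| <= M * (t - s).
Proof.
move=> st iF FM; apply: (le_trans (le_normr_Rintegral _ _)) => //.
have -> : M * (t - s) = \int[mu]_(x in `[s, t[) (cst M x).
  rewrite Rintegral_cst//= lebesgue_measure_itv/= lte_fin.
  by case: ltgtP st => // -> _; rewrite subrr.
apply: le_Rintegral => //.
- exact: (integrable_norm iF).
- by apply: continuous_integrable_itv => x; exact: cvg_cst.
Qed.

Lemma continuous_Rintegral_clamp F T : 0 <= T -> continuous F ->
  continuous (fun t => \int[mu]_(x in `[0, clamp T t[) F x).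
Proof.
move=> T0 Fc.
apply: (@continuous_comp_clamp _ T (fun t => \int[mu]_(x in `[0, t[) F x)) => //.
apply: (@subspace_eq_continuous _ _ _ (fun t => \int[mu]_(x in `[0, t]) F x)).
  move=> t /[!inE] _; rewrite /from_subspace/= -Rintegral_itv_bndo_bndc//.
  exact: continuous_integrable_itv.
apply: parameterized_integral_continuous => //.
apply: continuous_compact_integrable; first exact: segment_compact.
exact: continuous_subspaceT.
Qed.

End Integrals.

Section ImproperIntegral.
Context {R : realType}.
Notation mu := (@lebesgue_measure R).
Implicit Types (F : R -> R) (s t a : R).

(** Heine's theorem, by covering compactness with respect to the parameter
    [d] tending to [0]. *)
Lemma uniform_continuity_segment F a t e : continuous F -> 0 < e ->
  exists2 d, 0 < d & forall x y, a <= x <= t -> `|y - x| < d -> `|F y - F x| < e.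
Proof.
move=> Fc e0; have /compact_near_coveringP K := @segment_compact R a t.
have {K} := K R 0^'+ (fun d x => forall y, `|y - x| < d -> `|F y - F x| < e).
have cov x : `[a, t]%classic x -> \forall x' \near x & d \near 0^'+,
    forall y, `|y - x'| < d -> `|F y - F x'| < e.
  move=> _; have e2 : 0 < e / 2 by rewrite divr_gt0.
  have /cvgrPdist_lt/(_ _ e2)/nbhs_ballP[d /= d0 dP] := Fc x.
  exists (ball x (d / 2), [set r | r < d / 2]) => /=.
    by split; [apply: nbhsx_ballx|apply: nbhs_right_lt]; rewrite divr_gt0.
  move=> [x' r]/= [xx' rd] y yx'; rewrite /ball/= in xx'.
  have h1 : `|F x - F x'| < e / 2.
    by apply: dP; rewrite /ball/= (lt_le_trans xx')// ler_pdivrMr// ler_pMr// ler1n.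
  have h2 : `|F x - F y| < e / 2.
    apply: dP; rewrite /ball/= distrC (_ : y - x = (y - x') - (x - x')); last by lra.
    apply: (le_lt_trans (ler_normB _ _)); lra.
  rewrite distrC (_ : F x' - F y = (F x - F y) - (F x - F x')); last by lra.
  by apply: (le_lt_trans (ler_normB _ _)); lra.
move=> /(_ _ cov)/nbhs_right0P/= H.
have [d [d0 dP]] : exists d, 0 < d /\ `[a, t] `<=`
    (fun x => forall y, `|y - x| < d -> `|F y - F x| < e).
  near (0:R)^'+ => d; exists d; split => //.
  by near: d; exact/nbhs_right0P.
by exists d => // x y xat; apply: dP; rewrite /= in_itv.
Unshelve. all: by end_near. Qed.

(** Riemann sums evaluate the path at finitely many fixed times, hence transfer
    measurability in a random parameter from the values of a process to its time
    integral. *)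
Lemma riemann_sum_cvg F t : continuous F -> 0 <= t ->
  (fun N : nat => \sum_(i < N.+1) t / N.+1%:R * F (i%:R * (t / N.+1%:R)))
    @ \oo --> \int[mu]_(x in `[0, t[) F x.
Proof.
move=> Fc t0; apply/cvgrPdist_le => e e0.
have [d d0 dP] := uniform_continuity_segment 0 t Fc (divr_gt0 e0 (ltr_wpDl t0 ltr01)).
near=> N; set h := t / N.+1%:R.
have h0 : 0 <= h by rewrite divr_ge0.
have hd : h < d.
  rewrite /h ltr_pdivrMr// mulrC -ltr_pdivrMr//.
  by apply: (@lt_trans _ _ N%:R); [near: N; exact: nbhs_infty_gtr|rewrite ltr_nat].
have ht : N.+1%:R * h = t by rewrite /h mulrC divfK ?gt_eqF.
have iF s u : mu.-integrable `[s, u[ (fun x => (F x)%:E).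
  exact: continuous_integrable_itv.
(* The error is at most [e / (t + 1) * h] per cell, [h] being the mesh; adding
   up the [N.+1] cells of total length [t] leaves less than [e]. *)
have step (n : nat) : `|\int[mu]_(x in `[0, n%:R * h[) F x
    - \sum_(i < n) h * F (i%:R * h)| <= n%:R * (e / (t + 1) * h) \/ (N.+1 < n)%N.
  elim: n => [|n [IH|IH]]; last by right; exact: ltn_trans IH _.
    left; rewrite big_ord0 !mul0r subr0 set_itv_ge ?bnd_simp//.
    by rewrite Rintegral_set0 normr0.
  have [nN|] := leqP n.+1 N.+1; [left|by right].
  have nh : 0 <= n%:R * h <= n.+1%:R * h.
    by rewrite mulr_ge0//= ler_wpM2r// ler_nat.
  rewrite (Rintegral_itv_cat nh)// big_ord_recr/=.
  set I1 := \int[mu]_(x in `[0, _[) _ in IH *; set S := \sum_(i < n) _ in IH *.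
  have hE : h * F (n%:R * h) = \int[mu]_(x in `[n%:R * h, n.+1%:R * h[) F (n%:R * h).
    rewrite Rintegral_cst//= lebesgue_measure_itv/= lte_fin.
    rewrite -natr1 mulrDl mul1r; case: ltP => [_|].
      by rewrite -EFinD/= [X in _ = _ * X]addrAC subrr add0r mulrC.
    by rewrite gerDl => h0'; rewrite (_ : h = 0) ?mul0r ?mulr0//; lra.
  have : `|\int[mu]_(x in `[n%:R * h, n.+1%:R * h[) F x - h * F (n%:R * h)|
      <= e / (t + 1) * h.
    have ic : mu.-integrable `[n%:R * h, n.+1%:R * h[ (fun x => (F (n%:R * h))%:E).
      by apply: continuous_integrable_itv => x; exact: cvg_cst.
    rewrite hE -RintegralB//.
    have -> : e / (t + 1) * h = e / (t + 1) * (n.+1%:R * h - n%:R * h).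
      by rewrite -mulrBl -natrB// subSnn mul1r.
    apply: Rintegral_lip; [by case/andP: nh| |].
      by have := integrableB _ (iF (n%:R * h) (n.+1%:R * h)) ic; apply.
    move=> x /andP[nx xn]; apply/ltW/dP.
      by rewrite mulr_ge0//= -ht ler_wpM2r// ler_nat ltnW.
    rewrite ger0_norm ?subr_ge0//; apply: lt_trans hd.
    by move: xn; rewrite -natr1; lra.
  move=> H2; rewrite -[X in _ <= X * _]natr1 [leRHS]mulrDl mul1r.
  rewrite (_ : _ - _ = (I1 - S) + (\int[mu]_(x in `[n%:R * h, n.+1%:R * h[) F x -
     h * F (n%:R * h))); last by lra.
  by apply: (le_trans (ler_normD _ _)); exact: lerD.
case: (step N.+1); last by rewrite ltnn.
rewrite ht => /le_trans; apply.
rewrite mulrCA ht mulrAC ler_pdivrMr ?ltr_wpDl// ler_pM2l//.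
by rewrite lerDl.
Unshelve. all: by end_near. Qed.

(** An integrand of constant sign near the endpoint is integrable as soon as its
    integrals stay bounded, by monotone convergence along the intervals
    [[s0, t_ n]] exhausting [[s0, tau]]. *)
Lemma improper_integral F s0 tau L : 0 <= s0 < tau ->
  (forall t, 0 <= t < tau -> mu.-integrable `[0, t[ (fun x => (F x)%:E)) ->
  (forall x, s0 <= x < tau -> 0 <= F x) ->
  (fun t => \int[mu]_(x in `[0, t[) F x) @ tau^'- --> L ->
  mu.-integrable `[0, tau[ (fun x => (F x)%:E) /\
  \int[mu]_(x in `[0, tau[) F x = L.
Proof.
move=> /andP[s00 s0tau] iF F0 FL.
pose t_ (n : nat) := tau - (tau - s0) / n.+1%:R.
have tn n : s0 <= t_ n < tau.
  rewrite /t_ ltrBlDr ltrDl divr_gt0 ?subr_gt0// andbT.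
  by rewrite lerBrDl -lerBrDr ler_pdivrMr// ler_peMr ?ler1n// subr_ge0 ltW.
have t_cvg : t_ n @[n --> \oo] --> tau.
  rewrite -[X in _ --> X]subr0; apply: cvgB; first exact: cvg_cst.
  rewrite -[X in _ --> X](mulr0 (tau - s0)); apply: cvgM; first exact: cvg_cst.
  exact: cvg_harmonic.
have Ucov : \bigcup_n `[s0, t_ n[%classic = `[s0, tau[%classic :> set R.
  apply/seteqP; split => [x [n _]|x] /=; rewrite !in_itv/= => /andP[s0x xt].
    by rewrite s0x (lt_trans xt)//; case/andP: (tn n).
  have [n _ /(_ n (leqnn n))] := (cvgr_gt _ t_cvg _ xt).
  by move=> nx; exists n => //=; rewrite in_itv/= s0x.
have itn n : mu.-integrable `[0, t_ n[ (fun x => (F x)%:E).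
  by have /andP[h1 h2] := tn n; apply: iF; rewrite h2 (le_trans s00).
have mF n := measurable_int mu (integrable_itv_sub s00 (lexx (t_ n)) (itn n)).
have mono : nondecreasing_seq (fun n => `[s0, t_ n[%classic : set R).
  move=> m n mn; rewrite subsetEset; apply: subset_itv; rewrite bnd_simp//.
  rewrite /t_ lerD2l lerN2 ler_wpM2l ?subr_ge0 ?(ltW s0tau)//.
  by rewrite lef_pV2 ?posrE// ler_nat.
have cv := ge0_nondecreasing_set_cvg_integral (mu := mu) mono
  (fun=> measurable_itv _) mF.
have {cv} : (\int[mu]_(x in `[s0, t_ n[) (F x)%:E)%E @[n --> \oo] -->
    (\int[mu]_(x in `[s0, tau[) (F x)%:E)%E.
  rewrite -Ucov; apply: cv => n x /=; rewrite in_itv/= lee_fin => /andP[h1 h2].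
  by apply: F0; rewrite h1 (lt_trans h2)//; case/andP: (tn n).
have i0 : mu.-integrable `[0, s0[ (fun x => (F x)%:E) by apply: iF; rewrite s00.
have -> : (fun n => (\int[mu]_(x in `[s0, t_ n[) (F x)%:E)%E) =
    EFin \o (fun n => \int[mu]_(x in `[0, t_ n[) F x - \int[mu]_(x in `[0, s0[) F x).
  apply/funext => n /=; have /andP[stn tnt] := tn n.
  rewrite (@Rintegral_itv_cat _ F 0 s0) ?s00//.
  rewrite addrAC subrr add0r fineK//; apply: integrable_fin_num => //.
  exact: integrable_itv_sub (itn n).
have cvL : \int[mu]_(x in `[0, t_ n[) F x - \int[mu]_(x in `[0, s0[) F x
    @[n --> \oo] --> L - \int[mu]_(x in `[0, s0[) F x.
  apply: cvgB; last exact: cvg_cst.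
  move/cvg_at_leftP : FL; apply; split => // n; first by case/andP: (tn n).
move=> cvI; have {cvI} intE : (\int[mu]_(x in `[s0, tau[) (F x)%:E =
    (L - \int[mu]_(x in `[0, s0[) F x)%:E)%E.
  rewrite -(cvg_lim (@ereal_hausdorff R) cvI); apply: cvg_lim => //.
  by apply/fine_cvgP; split => //; exact: nearW.
have i1 : mu.-integrable `[s0, tau[ (fun x => (F x)%:E).
  apply/integrableP; split; first by rewrite -Ucov; apply/measurable_fun_bigcup => // n; exact: mF.
  apply: (@le_lt_trans _ _ (\int[mu]_(x in `[s0, tau[) (F x)%:E)%E).
    rewrite le_eqVlt; apply/orP; left; apply/eqP; apply: eq_integral.
    by move=> x /[!inE]/=; rewrite in_itv/= => xs; rewrite ger0_norm// F0.
  by rewrite intE ltry.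
have E : `[0, tau[%classic = `[0, s0[ `|` `[s0, tau[ :> set R.
  by apply: itv_bndbnd_setU; rewrite bnd_simp// ltW.
have iT : mu.-integrable `[0, tau[ (fun x => (F x)%:E).
  have [i0' i1'] := (i0, i1).
  move/integrableP : i0 => [mF0 lt0]; move/integrableP : i1 => [mF1 lt1].
  rewrite E; apply/integrableP; split; first exact/measurable_funU.
  rewrite ge0_integral_setU//.
  - exact: lte_add_pinfty.
  - by apply/measurable_funU => //; split; [case/integrableP: (integrable_abse i0')|
      case/integrableP: (integrable_abse i1')].
  - apply/disj_setPS => x /= []; rewrite !in_itv/= => /andP[_ xs] /andP[sx _].
    by move: (lt_le_trans xs sx); rewrite ltxx.
split => //; rewrite (@Rintegral_itv_cat _ F 0 s0) ?s00 ?ltW//.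
by rewrite [X in _ + X]/Rintegral intE/= addrC subrK.
Qed.

End ImproperIntegral.

(** * Volterra equations with a globally Lipschitz drift *)

Section Volterra.
Context {R : realType}.
Notation mu := (@lebesgue_measure R).
Implicit Types (F G u v g : R -> R) (s t a c : R).

Lemma le_geometric_half_le0 (K D : R) :
  (forall k, D <= K / 2 ^+ k) -> D <= 0.
Proof.
move=> H; rewrite leNgt; apply/negP => D0.
have K0 : 0 < K by have := H 0%N; rewrite expr0 divr1; exact: lt_le_trans.
have [n] : exists n : nat, K / D < n%:R.
  by exists (Num.Def.archi_bound (K / D)); rewrite archi_boundP// divr_ge0// ltW.
rewrite ltr_pdivrMr// => Kn; have := H n; rewrite ler_pdivlMr ?exprn_gt0//.
rewrite leNgt => /negP; apply; apply: (lt_le_trans Kn).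
by rewrite mulrC ler_pM2l// -natrX ler_nat ltnW// ltn_expl.
Qed.

(** The difference of two solutions is bounded by [M / 2 ^+ k * expR (2 * c * s)]
    for every [k]: each pass through the equation halves the bound. *)
Lemma volterra_unique F G u v g c (M : R) t : 0 < c ->
  mu.-integrable `[0, t[ (fun x => (F x)%:E) ->
  mu.-integrable `[0, t[ (fun x => (G x)%:E) ->
  (forall s, 0 <= s <= t -> u s = g s + \int[mu]_(x in `[0, s[) F x) ->
  (forall s, 0 <= s <= t -> v s = g s + \int[mu]_(x in `[0, s[) G x) ->
  (forall x, 0 <= x < t -> `|F x - G x| <= c * `|u x - v x|) ->
  (forall s, 0 <= s <= t -> `|u s - v s| <= M) ->
  forall s, 0 <= s <= t -> u s = v s.
Proof.
move=> c0 iF iG uE vE FG uvM.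
have a0 : 0 < 2 * c by rewrite mulr_gt0.
have H k : forall s, 0 <= s <= t -> `|u s - v s| <= M / 2 ^+ k * expR (2 * c * s).
  elim: k => [|k IH] s /andP[s0 st].
    have M0 : 0 <= M by apply: le_trans (uvM s _) => //; rewrite s0.
    apply: (le_trans (uvM s _)); rewrite ?s0// expr0 divr1 ler_peMr//.
    by rewrite -[leLHS]expR0 ler_expR mulr_ge0// ltW.
  have M0 : 0 <= M by apply: le_trans (uvM s _) => //; rewrite s0.
  rewrite uE ?s0// vE ?s0// (_ : _ - _ = \int[mu]_(x in `[0, s[) F x -
    \int[mu]_(x in `[0, s[) G x); last by lra.
  have := @Rintegral_dist_expR _ F G (c * (M / 2 ^+ k)) (2 * c) s a0 s0.
  rewrite (_ : c * (M / 2 ^+ k) / (2 * c) = M / 2 ^+ k.+1); last first.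
    by rewrite exprS; field; rewrite ?expf_neq0 ?(gt_eqF c0)// pnatr_eq0.
  apply; first by rewrite mulr_ge0 ?(ltW c0)// divr_ge0// exprn_ge0.
  - exact: integrable_itv_sub iF.
  - exact: integrable_itv_sub iG.
  - move=> x /andP[x0 xs]; apply: (le_trans (FG x _)).
      by rewrite x0 (lt_le_trans xs).
    rewrite -[leRHS]mulrA ler_wpM2l ?(ltW c0)// IH// x0.
    by rewrite (le_trans (ltW xs)).
move=> s st; apply/eqP; rewrite -subr_eq0 -normr_eq0 eq_le normr_ge0 andbT.
apply: (le_geometric_half_le0 (K := M * expR (2 * c * s))) => k.
by apply: (le_trans (H k s st)); rewrite mulrAC.
Qed.

Lemma geometric_cvg (u : nat -> R) (K : R) :
  (forall k, `|u k.+1 - u k| <= K / 2 ^+ k) ->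
  cvgn u /\ forall k, `|limn u - u k| <= 2 * K / 2 ^+ k.
Proof.
move=> uK; have K0 : 0 <= K by have := uK 0%N; rewrite expr0 divr1; exact: le_trans.
have ud k m : `|u (k + m)%N - u k| <= 2 * K / 2 ^+ k.
  suff: `|u (k + m)%N - u k| <= 2 * K / 2 ^+ k - 2 * K / 2 ^+ (k + m).
    move=> /le_trans; apply; rewrite gerBl divr_ge0 ?mulr_ge0//.
  elim: m => [|m IH]; first by rewrite addn0 !subrr normr0.
  rewrite addnS (_ : u _.+1 - _ = (u (k + m).+1 - u (k + m)%N) + (u (k + m)%N - u k));
    last by lra.
  apply: (le_trans (ler_normD _ _)); have := uK (k + m)%N.
  have -> : 2 * K / 2 ^+ (k + m).+1 = K / 2 ^+ (k + m).
    by rewrite exprS; field; rewrite expf_neq0// pnatr_eq0.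
  by move: IH; rewrite (_ : 2 * K / 2 ^+ (k + m) = 2 * (K / 2 ^+ (k + m))) ?mulrA//; lra.
have uc : cvgn u.
  apply: cauchy_cvg; apply/cauchy_exP => e e0.
  have : (fun k => 2 * K / 2 ^+ k) @ \oo --> 0.
    have -> : (fun k : nat => 2 * K / 2 ^+ k) = geometric (2 * K) 2^-1.
      by apply/funext => k; rewrite /geometric/= exprVn.
    by apply: cvg_geometric; rewrite ger0_norm ?invr_ge0// invf_lt1 ?ltr1n.
  move=> /(cvgr_lt 0)/(_ e e0)[k _ /(_ k (leqnn k))/= ke].
  exists (u k); exists k => // m /= km; rewrite /ball/= distrC.
  by rewrite -(subnKC km); exact: le_lt_trans (ud _ _) ke.
split => // k; apply/ler_normlP; rewrite opprB; split.
  rewrite lerBlDl -lerBlDr; apply: limr_ge => //.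
  near=> m; have km : (k <= m)%N by near: m; exists k.
  by have := ud k (m - k)%N; rewrite subnKC// => /ler_normlP[]; lra.
rewrite lerBlDl; apply: limr_le => //.
near=> m; have km : (k <= m)%N by near: m; exists k.
by have := ud k (m - k)%N; rewrite subnKC// => /ler_normlP[]; lra.
Unshelve. all: by end_near. Qed.

Lemma continuous_along (f : R -> R -> R) (k u : R -> R) :
  continuous (fun p : R * R => f p.1 p.2) -> continuous k -> continuous u ->
  continuous (fun t => f (k t) (u t)).
Proof.
move=> fc kc uc t.
apply: (@continuous_comp _ _ _ (fun t => (k t, u t)) (fun p : R * R => f p.1 p.2)).
  exact: (@cvg_pair R R R (nbhs t) (nbhs (k t)) (nbhs (u t)) _ _ _ k u (kc t) (uc t)).
exact: fc.
Qed.

(** The integral runs up to [clamp T t], so that every iterate is continuous on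
    the whole line. *)
Fixpoint picard (f : R -> R -> R) T g k : R -> R :=
  if k is k'.+1 then
    fun t => g t + \int[mu]_(x in `[0, clamp T t[) f x (picard f T g k' x)
  else g.

Definition volterra f T g t := limn (fun k => picard f T g k t).

Section Picard.
Variables (f : R -> R -> R) (T c : R) (g : R -> R).
Hypotheses (T0 : 0 <= T) (c0 : 0 < c).
Hypothesis f_cont : continuous (fun p : R * R => f p.1 p.2).
Hypothesis f_lip : forall t x y, `|f t x - f t y| <= c * `|x - y|.
Hypothesis g_cont : continuous g.

Let along_cont u : continuous u -> continuous (fun t => f t (u t)).
Proof. by move=> uc; apply: (continuous_along f_cont _ uc) => t; exact: cvg_id. Qed.

Lemma picard_continuous k : continuous (picard f T g k).
Proof.
elim: k => [|k IH] //= t.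
by apply: cvgD; [exact: g_cont|apply: continuous_Rintegral_clamp => //; exact: along_cont].
Qed.

(** Successive iterates approach each other geometrically in the norm weighted
    by [expR (2 * c * t)], whatever the length [T] of the interval. *)
Lemma picard_step : exists2 M : R, 0 <= M & forall k t,
  `|picard f T g k.+1 t - picard f T g k t|
    <= M / 2 ^+ k * expR (2 * c * clamp T t).
Proof.
have [M M0 fM] := bounded_on_segment T0 (continuous_subspaceT (along_cont g_cont)).
have MT : 0 <= M * T by rewrite mulr_ge0// ltW.
exists (M * T) => //; elim=> [|k IH] t; have /andP[ct0 ctT] := clamp_itv t T0.
  rewrite expr0 divr1 /= [g t + _]addrC addrK.
  have icg := continuous_integrable_itv 0 (clamp T t) (along_cont g_cont).
  apply: (le_trans (Rintegral_lip (M := M) ct0 icg _)).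
    by move=> x /andP[x0 xt]; apply: fM; rewrite x0 (le_trans (ltW xt)).
  rewrite subr0; apply: (@le_trans _ _ (M * T)); first by rewrite ler_wpM2l// ltW.
  by rewrite ler_peMr// -[leLHS]expR0 ler_expR mulr_ge0// mulr_ge0// ltW.
have a0 : 0 < 2 * c by rewrite mulr_gt0.
rewrite (_ : _ - _ = \int[mu]_(x in `[0, clamp T t[) f x (picard f T g k.+1 x) -
  \int[mu]_(x in `[0, clamp T t[) f x (picard f T g k x)); last by rewrite /=; lra.
have := Rintegral_dist_expR (K := c * (M * T / 2 ^+ k)) a0 ct0.
rewrite (_ : c * (M * T / 2 ^+ k) / (2 * c) = M * T / 2 ^+ k.+1); last first.
  by rewrite exprS; field; rewrite ?expf_neq0 ?(gt_eqF c0)// pnatr_eq0.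
apply.
- by rewrite mulr_ge0 ?(ltW c0)// divr_ge0// exprn_ge0.
- exact/continuous_integrable_itv/along_cont/picard_continuous.
- exact/continuous_integrable_itv/along_cont/picard_continuous.
- move=> x /andP[x0 xt]; apply: (le_trans (f_lip _ _ _)).
  rewrite -[leRHS]mulrA ler_wpM2l ?(ltW c0)//; have := IH x.
  by rewrite clamp_id// x0 (le_trans (ltW xt)).
Qed.

Lemma picard_cvg t : cvgn (fun k => picard f T g k t).
Proof.
have [M M0 MP] := picard_step.
have [] // := @geometric_cvg (fun k => picard f T g k t)
  (M * expR (2 * c * clamp T t)).
by move=> k; rewrite mulrAC; exact: MP.
Qed.

Lemma picard_dist : exists2 M : R, 0 <= M & forall k t,
  `|volterra f T g t - picard f T g k t| <= M / 2 ^+ k.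
Proof.
have [M M0 MP] := picard_step.
exists (2 * (M * expR (2 * c * T))).
  by rewrite mulr_ge0// mulr_ge0// expR_ge0.
move=> k t; have uK j : `|picard f T g j.+1 t - picard f T g j t|
    <= M * expR (2 * c * T) / 2 ^+ j.
  rewrite mulrAC; apply: (le_trans (MP j t)).
  rewrite ler_wpM2l ?divr_ge0 ?exprn_ge0// ler_expR ler_wpM2l//.
    by rewrite mulr_ge0// ltW.
  by case/andP: (clamp_itv t T0).
by have [_] := geometric_cvg uK; apply.
Qed.

Lemma volterra_continuous : continuous (volterra f T g).
Proof.
have [M M0 MP] := picard_dist => t; apply/cvgrPdist_lt => e e0.
have [k Mk] : exists k : nat, M / 2 ^+ k < e / 3.
  apply: contrapT => /forallNP H; have e3 : 0 < e / 3 by rewrite divr_gt0.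
  suff : e / 3 <= 0 by rewrite leNgt e3.
  by apply: (le_geometric_half_le0 (K := M)) => k; rewrite leNgt; apply/negP.
have e3 : 0 < e / 3 by rewrite divr_gt0.
have /cvgrPdist_lt/(_ _ e3) := @picard_continuous k t.
apply: filterS => s ts.
rewrite (_ : volterra f T g t - _ = (volterra f T g t - picard f T g k t) +
  (picard f T g k t - picard f T g k s) - (volterra f T g s - picard f T g k s));
  last by lra.
apply: (le_lt_trans (ler_normB _ _)).
have := ler_normD (volterra f T g t - picard f T g k t)
  (picard f T g k t - picard f T g k s).
by have := MP k t; have := MP k s; lra.
Qed.

Lemma volterra_eq t : 0 <= t <= T ->
  volterra f T g t = g t + \int[mu]_(x in `[0, t[) f x (volterra f T g x).
Proof.
move=> /andP[t0 tT]; have [M M0 MP] := picard_dist.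
apply/eqP; rewrite -subr_eq0 -normr_eq0 eq_le normr_ge0 andbT.
apply: (le_geometric_half_le0 (K := M + c * M * t)) => k.
have iP := continuous_integrable_itv 0 t (along_cont (@picard_continuous k)).
have iV := continuous_integrable_itv 0 t (along_cont volterra_continuous).
have pE : picard f T g k.+1 t =
  g t + \int[mu]_(x in `[0, t[) f x (picard f T g k x).
  by rewrite /= clamp_id// t0.
rewrite (_ : volterra f T g t - _ = (volterra f T g t - picard f T g k.+1 t) +
  (\int[mu]_(x in `[0, t[) f x (picard f T g k x) -
   \int[mu]_(x in `[0, t[) f x (volterra f T g x))); last by rewrite pE; lra.
apply: (le_trans (ler_normD _ _)); rewrite mulrDl; apply: lerD.
  apply: (le_trans (MP _ _)); rewrite ler_wpM2l// lef_pV2 ?posrE ?exprn_gt0//.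
  by rewrite exprS ler_peMl ?exprn_ge0// ler1n.
rewrite -RintegralB//.
rewrite (_ : c * M * t / 2 ^+ k = c * (M / 2 ^+ k) * (t - 0)); last first.
  by rewrite subr0; field; rewrite expf_neq0// pnatr_eq0.
apply: Rintegral_lip => //; first by have := integrableB _ iP iV; apply.
move=> x _; apply: (le_trans (f_lip _ _ _)); rewrite ler_pM2l//.
by rewrite distrC; exact: MP.
Qed.

End Picard.
End Volterra.

(** * The regularized equations and the maximal solution of one path *)

Section Path.
Context {R : realType}.
Notation mu := (@lebesgue_measure R).
Variables (T : R) (phi : R -> R) (b : R -> R -> R).
Implicit Types (g u : R -> R) (s t : R).

(** Freezing the drift below height [n.+1%:R^-1] above [phi] makes it globally
    Lipschitz in space by (A2), without changing it above that height. *)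
Definition regular_drift n t y :=
  b (clamp T t) (Num.max y (phi (clamp T t) + n.+1%:R^-1)).

Definition approx g n := volterra (regular_drift n) T g.

(** As long as [alive g n t] holds, the [n]-th regularized path has not met the
    frozen zone and therefore solves the original equation. *)
Definition alive g n t := forall s, 0 <= s <= t -> phi s + n.+1%:R^-1 <= approx g n s.

(** The maximal solution is patched with [phi] after its death. The patch is
    written without stopping times: only the event of being alive enters, which
    makes measurability in the random parameter easy. *)
Definition stopped g n t :=
  if `[< alive g n (clamp T t) >] then approx g n (clamp T t) else phi (clamp T t).

Definition sol g t := limn (fun n => stopped g n t).

(** [equation_at] with the constant and the noise gathered in one forcing path
    [g]. *)
Definition solves g u s :=
  mu.-integrable `[0, s[ (fun r => (b r (u r))%:E) /\
  u s = g s + \int[mu]_(r in `[0, s[) b r (u r).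

Hypothesis T0 : 0 <= T.
Hypothesis phi_cont : {within `[0, T], continuous phi}.
Hypothesis A1 : drift_continuous T phi b.
Hypothesis A2 : drift_lipschitz T phi b.

Let eps_gt0 n : 0 < n.+1%:R^-1 :> R. Proof. by rewrite invr_gt0. Qed.

Lemma phi_clamp_continuous : continuous (phi \o clamp T).
Proof. exact: continuous_comp_clamp. Qed.

Lemma regular_drift_continuous n :
  continuous (fun p : R * R => regular_drift n p.1 p.2).
Proof.
pose k (p : R * R) := (clamp T p.1, Num.max p.2 (phi (clamp T p.1) + n.+1%:R^-1)).
have kc : continuous k.
  move=> p.
  have c1 : {for p, continuous (fun p : R * R => clamp T p.1)}.
    by apply: continuous_comp; [exact: cvg_fst|exact: continuous_clamp].
  have c2 : {for p, continuous (fun p : R * R => phi (clamp T p.1) + n.+1%:R^-1)}.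
    apply: (@cvgD _ R _ _ _ (fun p : R * R => phi (clamp T p.1)) (cst n.+1%:R^-1));
      last exact: cvg_cst.
    apply: (@continuous_comp _ _ _ fst (phi \o clamp T)); first exact: cvg_fst.
    exact: phi_clamp_continuous.
  have c3 : {for p, continuous (fun p : R * R => Num.max p.2 (phi (clamp T p.1) + n.+1%:R^-1))}.
    by apply: (@continuous_max R _ snd _ p) => //; exact: cvg_snd.
  exact: (@cvg_pair _ R R (nbhs p) (nbhs _) (nbhs _) _ _ _ _ _ c1 c3).
apply: (@continuous_comp_within _ _ _ (domainD T phi 0) (fun p => b p.1 p.2) k) => //.
move=> p; split => /=; first exact: clamp_itv.
by rewrite addr0 lt_max ltrDl eps_gt0 orbT.
Qed.

Lemma regular_drift_lipschitz n : exists2 c, 0 < c &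
  forall t x y, `|regular_drift n t x - regular_drift n t y| <= c * `|x - y|.
Proof.
have e2 : 0 < n.+1%:R^-1 / 2 :> R by rewrite divr_gt0.
have [c c0 cP] := A2 e2; exists c => // t x y.
have dom z : domainD T phi (n.+1%:R^-1 / 2)
    (clamp T t, Num.max z (phi (clamp T t) + n.+1%:R^-1)).
  split => /=; first exact: clamp_itv.
  by rewrite lt_max ltrD2l ltr_pdivrMr// ltr_pMr// ltr1n orbT.
apply: (le_trans (cP _ _ _ (dom x) (dom y))); rewrite ler_pM2l//.
set a := phi _ + _.
by case: (leP x a); case: (leP y a) => *; rewrite ler_norml; apply/andP; split;
  have := ler_norm (x - y); have := ler_norm (- (x - y)); rewrite normrN; lra.
Qed.

Lemma regular_driftE n t y : 0 <= t <= T -> phi t + n.+1%:R^-1 <= y ->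
  regular_drift n t y = b t y.
Proof. by move=> tT ty; rewrite /regular_drift clamp_id// max_l. Qed.

Section OnePath.
Variable g : R -> R.
Hypothesis g_cont : continuous g.

Lemma approx_continuous n : continuous (approx g n).
Proof.
have [c c0 cP] := regular_drift_lipschitz n.
exact: (volterra_continuous T0 c0 (@regular_drift_continuous n) cP g_cont).
Qed.

Let regular_drift_approx_continuous n :
  continuous (fun s => regular_drift n s (approx g n s)).
Proof.
apply: (continuous_along (@regular_drift_continuous n)); last exact: approx_continuous.
by move=> t; exact: cvg_id.
Qed.

Lemma approx_eq n t : 0 <= t <= T -> approx g n t =
  g t + \int[mu]_(s in `[0, t[) regular_drift n s (approx g n s).
Proof.
have [c c0 cP] := regular_drift_lipschitz n.
exact: (volterra_eq T0 c0 (@regular_drift_continuous n) cP g_cont).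
Qed.

(** A solution at distance at least [n.+1%:R^-1] from [phi] does not see the
    freezing, hence also solves the [n]-th regularized equation, which has only
    one solution. *)
Lemma approx_unique n u t : 0 <= t <= T -> {within `[0, t], continuous u} ->
  (forall s, 0 <= s <= t -> phi s + n.+1%:R^-1 <= u s) ->
  (forall s, 0 <= s <= t -> solves g u s) ->
  forall s, 0 <= s <= t -> approx g n s = u s.
Proof.
move=> /andP[t0 tT] uc phiu us; have [c c0 cP] := regular_drift_lipschitz n.
have [M _ MP] : exists2 M, 0 < M & forall s, 0 <= s <= t -> `|approx g n s - u s| <= M.
  apply: (@bounded_on_segment _ (fun s => approx g n s - u s)) => // s.
  apply: cvgB; last exact: uc.
  exact: (continuous_subspaceT (@approx_continuous n)).
apply: (@volterra_unique _ (fun s => regular_drift n s (approx g n s))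
  (fun s => b s (u s)) (approx g n) u g c M t) => //.
- exact: continuous_integrable_itv.
- by have [] := us t (ltac:(by rewrite t0 lexx)).
- by move=> s /andP[s0 st]; apply: approx_eq; rewrite s0 (le_trans st).
- by move=> s st; case: (us s st).
- move=> x /andP[x0 xt]; rewrite -(@regular_driftE n x (u x)); first exact: cP.
    by rewrite x0 (le_trans (ltW xt)).
  by apply: phiu; rewrite x0 ltW.
Qed.

Lemma aliveS n s t : s <= t -> alive g n t -> alive g n s.
Proof. by move=> st H r /andP[r0 rs]; apply: H; rewrite r0 (le_trans rs). Qed.

Lemma alive_solves n t : 0 <= t <= T -> alive g n t -> solves g (approx g n) t.
Proof.
move=> /andP[t0 tT] al.
have E r : r \in `[0, t[%classic ->
    regular_drift n r (approx g n r) = b r (approx g n r).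
  rewrite inE/= in_itv/= => /andP[r0 rt]; apply: regular_driftE.
    by rewrite r0 (le_trans (ltW rt)).
  by apply: al; rewrite r0 ltW.
split.
  have := continuous_integrable_itv 0 t (@regular_drift_approx_continuous n).
  by apply: eq_integrable => //= r rt; rewrite E.
by rewrite approx_eq ?t0//; congr (_ + _); apply: eq_Rintegral => r /E.
Qed.

Lemma alive_mono n m t : (n <= m)%N -> 0 <= t <= T -> alive g n t ->
  alive g m t /\ forall s, 0 <= s <= t -> approx g m s = approx g n s.
Proof.
move=> nm /andP[t0 tT] al.
have le_eps s : phi s + m.+1%:R^-1 <= phi s + n.+1%:R^-1.
  by rewrite lerD2l lef_pV2 ?posrE// ler_nat.
have E s : 0 <= s <= t -> approx g m s = approx g n s.
  apply: (@approx_unique m _ t); rewrite ?t0//.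
  - exact: (continuous_subspaceT (@approx_continuous n)).
  - by move=> r rt; apply: (le_trans (le_eps r)); exact: al.
  - move=> r /andP[r0 rt]; apply: alive_solves; first by rewrite r0 (le_trans rt).
    exact: aliveS al.
split => // s st; rewrite E//; apply: (le_trans (le_eps s)); exact: al.
Qed.

(** By compactness a solution strictly above [phi] on [[0, t]] keeps a positive
    distance from it, so some regularized path follows it. Both uniqueness and
    maximality rest on this. *)
Lemma capture u t : 0 <= t <= T -> {within `[0, t], continuous u} ->
  (forall s, 0 <= s <= t -> phi s < u s) ->
  (forall s, 0 <= s <= t -> solves g u s) ->
  exists n, alive g n t /\ forall s, 0 <= s <= t -> approx g n s = u s.
Proof.
move=> /andP[t0 tT] uc phiu us.
have [c ct cmin] : exists2 c, c \in `[0, t]%R &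
    forall s, s \in `[0, t]%R -> u c - phi c <= u s - phi s.
  apply: (@EVT_min _ (fun s => u s - phi s)) => // s.
  apply: cvgB; first exact: uc.
  apply: (continuous_subspaceW _ phi_cont).
  by apply: subset_itv; rewrite bnd_simp.
have d0 : 0 < u c - phi c by rewrite subr_gt0 phiu//; move: ct; rewrite in_itv.
have [n _ /(_ n (leqnn n))/= nd] := near_infty_natSinv_lt (PosNum d0).
have phiun s : 0 <= s <= t -> phi s + n.+1%:R^-1 <= u s.
  move=> st; rewrite addrC -lerBrDr; apply: (le_trans (ltW nd)).
  by apply: cmin; rewrite in_itv.
have E := @approx_unique n u t (ltac:(by rewrite t0)) uc phiun us.
by exists n; split => // s st; rewrite E// phiun.
Qed.

Lemma stoppedE_cvg n t : 0 <= t <= T -> alive g n t ->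
  stopped g m t @[m --> \oo] --> approx g n t.
Proof.
move=> tT al; apply/cvgrPdist_le => e e0; exists n => // m /= nm.
rewrite /stopped clamp_id//; have [alm E] := alive_mono nm tT al.
have tt : 0 <= t <= t by rewrite lexx andbT; case/andP: tT.
by case: asboolP => // _; rewrite (E t tt) subrr normr0 ltW.
Qed.

Lemma sol_alive n t : 0 <= t <= T -> alive g n t -> sol g t = approx g n t.
Proof. by move=> tT al; apply/cvg_lim => //; exact: stoppedE_cvg. Qed.

Lemma sol_dead_cvg t : 0 <= t <= T -> (forall n, ~ alive g n t) ->
  stopped g m t @[m --> \oo] --> phi t.
Proof.
move=> tT al; apply/cvgrPdist_le => e e0; near=> m.
by rewrite /stopped clamp_id//; case: asboolP => [/al//|_]; rewrite subrr normr0 ltW.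
Unshelve. all: by end_near. Qed.

Lemma sol_dead t : 0 <= t <= T -> (forall n, ~ alive g n t) -> sol g t = phi t.
Proof. by move=> tT al; apply/cvg_lim => //; exact: sol_dead_cvg. Qed.

Lemma stopped_cvg t : stopped g m t @[m --> \oo] --> sol g t.
Proof.
have E : (fun m => stopped g m t) = (fun m => stopped g m (clamp T t)).
  by apply/funext => m; rewrite /stopped clampK.
rewrite /sol E; have tT := clamp_itv t T0.
have [[n al]|/forallNP al] := pselect (exists n, alive g n (clamp T t)).
  by have h := stoppedE_cvg tT al; rewrite (cvg_lim _ h).
by have h := sol_dead_cvg tT al; rewrite (cvg_lim _ h).
Qed.

Lemma sol_gtP t : 0 <= t <= T -> phi t < sol g t <-> exists n, alive g n t.
Proof.
move=> tT; split => [|[n al]].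
  by apply: contraPP => /forallNP al; rewrite sol_dead// ltxx.
rewrite (sol_alive tT al); apply: (lt_le_trans _ (al t _)); first by rewrite ltrDl.
by rewrite lexx andbT; case/andP: tT.
Qed.

(** Survival is an open condition: passing from [n] to [n.+1] leaves room below
    the approximation, which is continuous. *)
Lemma alive_open n t : 0 <= t < T -> alive g n t ->
  exists2 t', t < t' <= T & alive g n.+1 t'.
Proof.
move=> /andP[t0 tT] al.
have tT' : 0 <= t <= T by rewrite t0 ltW.
have [al' E] := alive_mono (leqnSn n) tT' al.
have d0 : 0 < n.+1%:R^-1 - n.+2%:R^-1 :> R.
  by rewrite subr_gt0 ltf_pV2 ?posrE// ltr_nat.
have tt : 0 <= t <= t by rewrite t0 lexx.
have hc : continuous (fun s => approx g n.+1 s - phi (clamp T s)).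
  by move=> s; apply: cvgB; [exact: approx_continuous|exact: phi_clamp_continuous].
have := hc t => /cvgrPdist_lt/(_ _ d0)/nbhs_ballP[d /= dd dP].
exists (Num.min T (t + d / 2)).
  by rewrite lt_min tT ltrDl divr_gt0//= ge_min lexx.
move=> s /andP[s0]; rewrite le_min => /andP[sT sd].
have [st|ts] := leP s t; first by apply: al'; rewrite s0.
have /dP : ball t d s by rewrite /ball/= ltr_norml; apply/andP; split; lra.
rewrite !clamp_id ?s0// E// => /ltr_normlP[_ h].
have := al t tt; move: h; move: (n.+1%:R^-1) (n.+2%:R^-1) => e1 e2; lra.
Qed.

(** * Behaviour of the maximal solution at its death *)

Hypothesis A3 : drift_repulsive T phi b.
Hypothesis g_gt0 : phi 0 < g 0.

Let drift (s : R) := b s (sol g s).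

Definition dies_at t :=
  (forall n, ~ alive g n t) /\ (forall s, 0 <= s < t -> exists n, alive g n s).

Lemma alive_start : exists n, alive g n 0.
Proof.
have d0 : 0 < g 0 - phi 0 by rewrite subr_gt0.
have [n _ /(_ n (leqnn n))/= nd] := near_infty_natSinv_lt (PosNum d0).
exists n => s /le_anti <-; rewrite approx_eq ?lexx// set_itv_ge ?bnd_simp//.
by rewrite Rintegral_set0 addr0 addrC -lerBrDr ltW.
Qed.

Lemma dies_at_gt0 t : 0 <= t -> dies_at t -> 0 < t.
Proof.
rewrite le_eqVlt => /predU1P[<- [al _]|//].
by have [n /al] := alive_start.
Qed.

Lemma sol_eq_approx n t : 0 <= t <= T -> alive g n t ->
  forall s, 0 <= s <= t -> sol g s = approx g n s.
Proof.
move=> /andP[t0 tT] al s /andP[s0 st]; apply: sol_alive; last exact: aliveS al.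
by rewrite s0 (le_trans st).
Qed.

Lemma sol_solves n t : 0 <= t <= T -> alive g n t -> solves g (sol g) t.
Proof.
move=> tT al; have /andP[t0 _] := tT; have [iA eA] := alive_solves tT al.
have E := sol_eq_approx tT al.
have E' r : r \in `[0, t[%classic -> b r (approx g n r) = b r (sol g r).
  by rewrite inE/= in_itv/= => /andP[r0 rt]; rewrite E// r0 ltW.
split; first by move: iA; apply: eq_integrable => //= r rt; rewrite E'.
by rewrite E ?t0 ?lexx// eA; congr (_ + _); exact: eq_Rintegral.
Qed.

Lemma sol_continuous_alive n t : 0 <= t <= T -> alive g n t ->
  {within `[0, t], continuous (sol g)}.
Proof.
move=> tT al; apply: (@subspace_eq_continuous _ _ _ (approx g n)).
  by move=> s /[!inE]/=; rewrite in_itv/= => st; rewrite /from_subspace (sol_eq_approx tT al).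
exact: (continuous_subspaceT (@approx_continuous n)).
Qed.

Lemma sol_ge_phi t : 0 <= t <= T -> phi t <= sol g t.
Proof.
move=> tT; have [al|/forallNP al] := pselect (exists n, alive g n t).
  by apply/ltW; exact/sol_gtP.
by rewrite sol_dead.
Qed.

(** If the gap stayed above [d] up to the death time, one regularized equation
    would coincide with the true one up to and including that time. *)
Lemma gap_gets_small t s0 d : 0 <= t <= T -> dies_at t -> 0 <= s0 < t -> 0 < d ->
  exists2 s, s0 <= s < t & sol g s - phi s < d.
Proof.
move=> /andP[t0 tT] [dead al] /andP[s00 s0t] d0; apply: contrapT => H.
have big s : s0 <= s < t -> phi s + d <= sol g s.
  move=> st; rewrite leNgt; apply/negP => sd; apply: H; exists s => //.
  by rewrite ltrBlDl.
have [n0 aln0] := al s0 (ltac:(by rewrite s00)).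
have s0T : 0 <= s0 <= T by rewrite s00 (le_trans (ltW s0t)).
have [n1 _ /(_ n1 (leqnn n1))/= n1d] := near_infty_natSinv_lt (PosNum d0).
(* [n0] handles the times before [s0] and [n1] those after it. *)
pose m := maxn n0 n1.
have em0 : m.+1%:R^-1 <= n0.+1%:R^-1 :> R by rewrite lef_pV2 ?posrE// ler_nat ltnS leq_maxl.
have em1 : m.+1%:R^-1 <= d.
  by apply: (le_trans _ (ltW n1d)); rewrite lef_pV2 ?posrE// ler_nat ltnS leq_maxr.
have above s : 0 <= s < t -> phi s + m.+1%:R^-1 <= sol g s.
  move=> /andP[sge0 st]; have [ss0|s0s] := leP s s0.
    rewrite (sol_eq_approx s0T aln0) ?sge0//.
    by apply: (le_trans _ (aln0 s _)); rewrite ?sge0// lerD2l.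
  by apply: (le_trans _ (big s _)); rewrite ?(ltW s0s)// lerD2l.
have eqm s : 0 <= s < t -> approx g m s = sol g s.
  move=> /andP[sge0 st]; have sT : 0 <= s <= T by rewrite sge0 (le_trans (ltW st)).
  have [n aln] := al s (ltac:(by rewrite sge0)).
  apply: (@approx_unique m (sol g) s) => //; last by rewrite sge0 lexx.
  - exact: sol_continuous_alive aln.
  - by move=> r /andP[r0 rs]; apply: above; rewrite r0 (le_lt_trans rs).
  - move=> r /andP[r0 rs]; apply: (@sol_solves n); last exact: aliveS aln.
    by rewrite r0 (le_trans rs)//; case/andP: sT.
apply: (dead m) => s /andP[sge0]; rewrite le_eqVlt => /predU1P[->|st]; last first.
  by rewrite eqm ?sge0// above// sge0.
rewrite leNgt; apply/negP => neg.
have hc : continuous (fun s => phi (clamp T s) + m.+1%:R^-1 - approx g m s).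
  move=> x; apply: cvgB; last exact: approx_continuous.
  by apply: cvgD; [exact: phi_clamp_continuous|exact: cvg_cst].
have tpos : 0 < phi (clamp T t) + m.+1%:R^-1 - approx g m t.
  by rewrite clamp_id ?t0// subr_gt0.
have := hc t => /cvgrPdist_lt/(_ _ tpos)/nbhs_ballP[e /= e0 eP].
pose x := Num.max 0 (t - e / 2).
have t_gt0 : 0 < t by exact: le_lt_trans s0t.
have xt : 0 <= x < t by rewrite le_max lexx/= gt_max t_gt0 gtrBl divr_gt0.
have /andP[x0 xt'] := xt.
have /eP : ball t e x.
  rewrite /ball/= ger0_norm ?subr_ge0 ?ltW//.
  have : t - e / 2 <= x by rewrite le_max lexx orbT.
  by lra.
have xT : 0 <= x <= T by rewrite x0 (le_trans (ltW xt')).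
rewrite (clamp_id xT) (eqm x)// => /ltr_normlP[_].
by have := above x xt; move: (m.+1%:R^-1) => em; lra.
Qed.

(** A descent of the gap from [v] to [v / 2] inside the zone where the drift is
    nonnegative is due to the noise alone, hence takes time bounded below. *)
Lemma gap_vanishes t v : 0 <= t <= T -> dies_at t -> 0 < v ->
  exists2 s0, 0 <= s0 < t & forall s, s0 <= s < t -> sol g s - phi s < v.
Proof.
move=> tT dt v0; have [/andP[t0 tT'] [dead al]] := (tT, dt).
have [ystar [c [gamma [ys0 c0 gamma0 rep]]]] := A3.
have t_gt0 := dies_at_gt0 t0 dt.
(* Below height [ystar] the drift is nonnegative. *)
pose w := Num.min v ystar.
have w0 : 0 < w by rewrite lt_min v0.
have hc : continuous (fun s => g s - phi (clamp T s)).
  by move=> x; apply: cvgB; [exact: g_cont|exact: phi_clamp_continuous].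
have w4 : 0 < w / 4 by rewrite divr_gt0.
have := hc t => /cvgrPdist_lt/(_ _ w4)/nbhs_ballP[e /= e0 eP].
pose s0 := Num.max 0 (t - e / 2).
have s0t : 0 <= s0 < t by rewrite le_max lexx/= gt_max t_gt0 gtrBl divr_gt0.
have /andP[s00 s0t'] := s0t.
have near_t s : s0 <= s < t -> `|g t - phi t - (g s - phi s)| < w / 4.
  move=> /andP[s0s st]; have se : t - e / 2 <= s.
    by apply: le_trans s0s; rewrite le_max lexx orbT.
  have /eP : ball t e s by rewrite /ball/= ger0_norm ?subr_ge0 ?ltW//; lra.
  by rewrite !clamp_id// ?(le_trans s00)//= (le_trans (ltW st)).
exists s0 => // s1 /andP[s0s1 s1t]; apply: (@lt_le_trans _ _ w); last first.
  by rewrite ge_min lexx.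
rewrite ltNge; apply/negP => ws1.
have s1_ge0 : 0 <= s1 := le_trans s00 s0s1.
have w2 : 0 < w / 2 by rewrite divr_gt0.
have s1t' : 0 <= s1 < t by rewrite s1_ge0.
have [s2 /andP[s12 s2t] s2w] := gap_gets_small tT dt s1t' w2.
have s2_ge0 : 0 <= s2 := le_trans s1_ge0 s12.
have s2T : 0 <= s2 <= T by rewrite s2_ge0 (le_trans (ltW s2t)).
have [n aln] := al s2 (ltac:(by rewrite s2_ge0)).
have Dc : {within `[s1, s2], continuous (fun s => sol g s - phi s)}.
  move=> x; apply: cvgB.
    apply: (continuous_subspaceW _ (sol_continuous_alive s2T aln)).
    by apply: subset_itv; rewrite bnd_simp.
  apply: (continuous_subspaceW _ phi_cont).
  by apply: subset_itv; rewrite bnd_simp//; case/andP: s2T.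
have s2w' : sol g s2 - phi s2 < w by lra.
have [r /andP[s1r rs2] [wr rw]] := last_passage s12 Dc ws1 s2w'.
have r_ge0 : 0 <= r := le_trans s1_ge0 s1r.
have rT : 0 <= r <= T by rewrite r_ge0 (le_trans (ltW rs2))//; case/andP: s2T.
have [iD eD] := sol_solves s2T aln.
have [_ eDr] := sol_solves rT (aliveS (ltW rs2) aln).
have irs := integrable_itv_sub r_ge0 (lexx s2) iD.
have r02 : 0 <= r <= s2 by rewrite r_ge0 ltW.
have eDrs := Rintegral_itv_cat r02 iD.
(* The gap is known to be below [w] only after [r]; one time has measure zero. *)
have pos : 0 <= \int[mu]_(x in `[r, s2[) b x (sol g x).
  rewrite -Rintegral_itv_obnd_cbnd.
    apply: Rintegral_ge0 => x /=; rewrite in_itv/= => /andP[rx xs2].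
    have xT : 0 <= x <= T.
      rewrite (le_trans r_ge0 (ltW rx))/= (le_trans (ltW xs2))//.
      by case/andP: s2T.
    have xw := rw x (ltac:(by rewrite rx ltW)).
    have aln' := aliveS (ltW xs2) aln.
    have /(sol_gtP xT) xphi : exists n, alive g n x by exists n.
    apply: le_trans (rep x (sol g x) _).
      by rewrite divr_ge0 ?ltW// powR_gt0// subr_gt0.
    split; first by split => //=; rewrite addr0.
    move=> [_ /=]; have : w <= ystar by rewrite ge_min lexx orbT.
    by lra.
  apply: (integrableS _ _ _ irs) => //; apply: subset_itv; rewrite bnd_simp//.
have /ltr_normlP[h1 h2] := near_t s2 (ltac:(by rewrite s2t (le_trans s0s1))).
have /ltr_normlP[h3 h4] := near_t r (ltac:(by rewrite (lt_trans rs2 s2t) (le_trans s0s1))).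
lra.
Qed.

(** Three cases at a time [t]: alive, where the path is locally a regularized
    one; dead for some time already, where it is [phi]; and the death time, where
    the vanishing gap glues the two. *)
Lemma sol_continuous : {within `[0, T], continuous (sol g)}.
Proof.
apply/within_continuousP => t e /=; rewrite in_itv/= => tT e0.
have /andP[t0 tT'] := tT.
have phic := phi_cont; move/within_continuousP : phic => phic.
have e2 : 0 < e / 2 by rewrite divr_gt0.
have [dp dp0 dpP] := phic t (e / 2) (ltac:(by rewrite /= in_itv/= tT)) e2.
have dieP s : 0 <= s <= T -> t <= s -> (forall n, ~ alive g n t) -> sol g s = phi s.
  by move=> sT ts dead; apply: sol_dead => // n /(aliveS ts)/dead.
have [[n al]|/forallNP dead] := pselect (exists n, alive g n t).
  have [t' [m [d [alm t'T d0 dP]]]] : exists t' m d, [/\ alive g m t',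
      0 <= t' <= T, 0 < d & forall s, s <= T -> s - t < d -> s <= t'].
    have [tltT|] := ltP t T.
      have t0T : 0 <= t < T by rewrite t0.
      have [t' /andP[tt' t'T] al'] := alive_open t0T al.
      exists t', n.+1, (t' - t); split => //; last by move=> s _; lra.
        by rewrite t'T andbT (le_trans t0 (ltW tt')).
      by rewrite subr_gt0.
    move=> Tt; exists t, n, 1; split => // s sT _; lra.
  have := @approx_continuous m t => /cvgrPdist_lt/(_ _ e0)/nbhs_ballP[d' /= d'0 d'P].
  exists (Num.min d d'); first by rewrite lt_min d0.
  move=> s; rewrite in_itv/= => /andP[s0 sT]; rewrite lt_min => /andP[std std'].
  have E := sol_eq_approx t'T alm.
  rewrite E; last by rewrite s0 dP//; move/ltr_normlP : std => [].
  rewrite E; last by rewrite t0 dP// subrr.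
  by rewrite distrC; apply: d'P; rewrite /ball/= distrC.
have [[s1 [/andP[s10 s1t] dead1]]|H] :=
    pselect (exists s1, 0 <= s1 < t /\ forall n, ~ alive g n s1).
  exists (Num.min dp (t - s1)); first by rewrite lt_min dp0 subr_gt0.
  move=> s sT; rewrite lt_min => /andP[sd1 /ltr_normlP[sd2 _]].
  have [sT1 sT2] := (sT, sT); rewrite /= in_itv/= in sT2.
  rewrite (sol_dead tT dead) (sol_dead sT2).
    by apply: (lt_trans (dpP s sT1 sd1)); lra.
  by move=> n; apply: contra_not (dead1 n); apply: aliveS; lra.
have dt : dies_at t.
  split => // s st; apply: contrapT => /forallNP ds; apply: H.
  by exists s.
have [s0 /andP[s00 s0t] s0P] := gap_vanishes tT dt e2.
exists (Num.min dp (t - s0)); first by rewrite lt_min dp0 subr_gt0.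
move=> s sT; rewrite lt_min => /andP[sd1 /ltr_normlP[sd2 _]].
have [sT1 sT2] := (sT, sT); rewrite /= in_itv/= in sT2.
have := dpP s sT1 sd1; rewrite (sol_dead tT dead).
have [ts|st] := leP t s; first by rewrite dieP// => /lt_trans; apply; lra.
have := s0P s (ltac:(by rewrite st andbT; lra)); have := sol_ge_phi sT2.
by move=> h1 h2 /ltr_normlP[h3 h4]; apply/ltr_normlP; split; lra.
Qed.

(** Near the death time the drift is nonnegative, so its integral converges
    there monotonically, to the value forced by the continuity of the path. *)
Lemma sol_solves_at_death t : 0 <= t <= T -> dies_at t -> solves g (sol g) t.
Proof.
move=> tT dt; have [/andP[t0 tT'] [dead al]] := (tT, dt).
have [ystar [c [gamma [ys0 c0 gamma0 rep]]]] := A3.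
have t_gt0 := dies_at_gt0 t0 dt.
have [s0 s0t s0P] := gap_vanishes tT dt ys0; have /andP[s00 s0t'] := s0t.
have eqs s : 0 <= s < t -> solves g (sol g) s.
  move=> /andP[sge0 st]; have [n aln] := al s (ltac:(by rewrite sge0)).
  by apply: sol_solves aln; rewrite sge0 (le_trans (ltW st)).
have [] := @improper_integral _ drift s0 t (sol g t - g t) s0t.
- by move=> s st; case: (eqs s st).
- move=> x /andP[s0x xt]; have x0 : 0 <= x := le_trans s00 s0x.
  have xT : 0 <= x <= T by rewrite x0 (le_trans (ltW xt)).
  have /(sol_gtP xT) xphi := al x (ltac:(by rewrite x0)).
  apply: le_trans (rep x (sol g x) _).
    by rewrite divr_ge0 ?ltW// powR_gt0// subr_gt0.
  split; first by split => //=; rewrite addr0.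
  by move=> [_ /=]; have := s0P x (ltac:(by rewrite s0x)); lra.
- apply/cvgrPdist_lt => e e0.
  have /within_continuousP sc := sol_continuous.
  have e2 : 0 < e / 2 by rewrite divr_gt0.
  have [d d0 dP] := sc t _ (ltac:(by rewrite /= in_itv/= tT)) e2.
  have := @g_cont t => /cvgrPdist_lt/(_ _ e2)/nbhs_ballP[d' /= d'0 d'P].
  near=> s.
  have st : s < t by near: s; exact: nbhs_left_lt.
  have s_ge0 : 0 <= s by near: s; exact: nbhs_left_ge.
  have sd : t - d < s by near: s; apply: nbhs_left_gt; rewrite gtrBl.
  have sd' : t - d' < s by near: s; apply: nbhs_left_gt; rewrite gtrBl.
  have [_ es] := eqs s (ltac:(by rewrite s_ge0)).
  have h1 : `|sol g s - sol g t| < e / 2.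
    apply: dP; first by rewrite /= in_itv/= s_ge0 (le_trans (ltW st)).
    by rewrite ltr0_norm ?subr_lt0//; lra.
  have h2 : `|g t - g s| < e / 2.
    by apply: d'P; rewrite /ball/= gtr0_norm ?subr_gt0//; lra.
  rewrite (_ : \int[mu]_(x in _) _ = sol g s - g s); last by rewrite es; lra.
  move/ltr_normlP : h1 => [h3 h4]; move/ltr_normlP : h2 => [h5 h6].
  by apply/ltr_normlP; split; lra.
- by move=> iD eD; split => //; rewrite eD; lra.
Unshelve. all: by end_near. Qed.

Hypothesis T_gt0 : 0 < T.

Lemma sol_start : sol g 0 = g 0.
Proof.
have [n al] := alive_start.
rewrite (@sol_alive n) ?lexx// approx_eq ?lexx// set_itv_ge ?bnd_simp//.
by rewrite Rintegral_set0 addr0.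
Qed.

Lemma sol_exit_timeP (tau := exit_time T phi (sol g)) : [/\ 0 < tau <= T,
  forall s, 0 <= s < tau -> phi s < sol g s, phi tau <= sol g tau &
  sol g tau = phi tau \/ tau = T].
Proof. by apply: exit_timeP => //; [exact: sol_continuous|rewrite sol_start]. Qed.

Lemma sol_solves_until_exit t : 0 <= t <= exit_time T phi (sol g) ->
  solves g (sol g) t.
Proof.
have [/andP[tau0 tauT] before _ _] := sol_exit_timeP.
move=> /andP[t0 ttau]; have tT : 0 <= t <= T by rewrite t0 (le_trans ttau).
have [[n al]|/forallNP dead] := pselect (exists n, alive g n t).
  exact: sol_solves al.
apply: sol_solves_at_death => //; split => // s /andP[s0 st].
have sT : 0 <= s <= T by rewrite s0 (le_trans (ltW st))//; case/andP: tT.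
by apply/sol_gtP => //; apply: before; rewrite s0 (lt_le_trans st).
Qed.

(** By [capture] the two solutions agree before the second one exits, hence also
    at that time by continuity. If one exited first, the common value at that time
    would be on [phi] and strictly above it. *)
Lemma sol_unique u : {within `[0, T], continuous u} -> u 0 = g 0 ->
  (forall t, 0 <= t < exit_time T phi u -> solves g u t) ->
  exit_time T phi (sol g) = exit_time T phi u /\
  forall t, 0 <= t <= exit_time T phi (sol g) -> u t = sol g t.
Proof.
move=> uc u0 us.
have [/andP[tau0 tauT] before ge alt] := sol_exit_timeP.
have [/andP[tau0' tauT'] before' ge' alt'] : [/\ 0 < exit_time T phi u <= T,
    forall s, 0 <= s < exit_time T phi u -> phi s < u s,
    phi (exit_time T phi u) <= u (exit_time T phi u) &
    u (exit_time T phi u) = phi (exit_time T phi u) \/ exit_time T phi u = T].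
  by apply: exit_timeP => //; rewrite u0.
set tau := exit_time T phi (sol g) in tau0 tauT before ge alt *.
set tau' := exit_time T phi u in us tau0' tauT' before' ge' alt' *.
have agree t : 0 <= t < tau' -> u t = sol g t.
  move=> /andP[t0 tt']; have tT : 0 <= t <= T by rewrite t0 (le_trans (ltW tt')).
  have uct : {within `[0, t], continuous u}.
    apply: (continuous_subspaceW _ uc); apply: subset_itv; rewrite bnd_simp//.
    by case/andP: tT.
  have [||n [al E]] := capture tT uct.
  - by move=> s /andP[s0 st]; apply: before'; rewrite s0 (le_lt_trans st).
  - by move=> s /andP[s0 st]; apply: us; rewrite s0 (le_lt_trans st).
  by rewrite (sol_alive tT al) E// t0 lexx.
have agree_tau' : u tau' = sol g tau'.
  have tau'I : `[0, T]%classic tau' by rewrite /= in_itv/= (ltW tau0').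
  have hc : {within `[0, T], continuous (fun s => u s - sol g s)}.
    by move=> x; apply: cvgB; [exact: uc|exact: sol_continuous].
  move/within_continuousP : hc => hc.
  apply/eqP; rewrite -subr_eq0; apply/negPn/negP; rewrite -normr_gt0 => ne.
  have [d d0 dP] := hc tau' _ tau'I ne.
  pose x := Num.max 0 (tau' - d / 2).
  have xt : 0 <= x < tau' by rewrite le_max lexx/= gt_max tau0' gtrBl divr_gt0.
  have /andP[x0 xtau] := xt.
  have xd : tau' - d / 2 <= x by rewrite le_max lexx orbT.
  have := dP x; rewrite (agree x)// subrr sub0r normrN ltxx /= in_itv/= x0.
  rewrite (le_trans (ltW xtau) tauT') => /(_ isT) H; suff : false by [].
  by apply: H; rewrite ltr0_norm ?subr_lt0//; lra.
have E : tau = tau'.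
  apply/eqP; rewrite eq_le; apply/andP; split; rewrite leNgt; apply/negP => lt.
    have : phi tau' < sol g tau' by apply: before; rewrite (ltW tau0').
    rewrite -agree_tau'; case: alt' => [->|E]; first by rewrite ltxx.
    by move: lt; rewrite E ltNge tauT.
  have tlt : 0 <= tau < tau' by rewrite (ltW tau0).
  have := before' tau tlt; rewrite agree//.
  case: alt => [->|E]; first by rewrite ltxx.
  by move: lt; rewrite E ltNge tauT'.
split => // t; rewrite E => /andP[t0]; rewrite le_eqVlt => /predU1P[->//|tt'].
by apply: agree; rewrite t0.
Qed.

End OnePath.
End Path.

(** * Measurability in the random parameter *)

Section Measurability.
Context {R : realType} {d : measure_display} {Omega : measurableType d}.
Notation mu := (@lebesgue_measure R).
Implicit Types (t : R) (X g : Omega -> R -> R).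

Lemma measurable_Rintegral_path X t : 0 <= t ->
  (forall w, continuous (X w)) ->
  (forall s, measurable_fun [set: Omega] (fun w => X w s)) ->
  measurable_fun [set: Omega] (fun w => \int[mu]_(s in `[0, t[) X w s).
Proof.
move=> t0 Xc mX.
apply: (@measurable_fun_cvg _ _ _ _ (fun (N : nat) w =>
   \sum_(i < N.+1) t / N.+1%:R * X w (i%:R * (t / N.+1%:R)))).
  by move=> N; apply: measurable_sum => i; apply: measurable_funM.
by move=> w _; exact: riemann_sum_cvg.
Qed.

Lemma measurable_volterra (f : R -> R -> R) (T c : R) g t : 0 <= T -> 0 < c ->
  continuous (fun p : R * R => f p.1 p.2) ->
  (forall t x y, `|f t x - f t y| <= c * `|x - y|) ->
  (forall w, continuous (g w)) ->
  (forall t, measurable_fun [set: Omega] (fun w => g w t)) ->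
  measurable_fun [set: Omega] (fun w => volterra f T (g w) t).
Proof.
move=> T0 c0 f_cont f_lip g_cont mg.
have mpicard k s : measurable_fun [set: Omega] (fun w => picard f T (g w) k s).
  elim: k s => [|k IH] s //=; apply: measurable_funD => //.
  apply: measurable_Rintegral_path => [|w|r].
  - by case/andP: (clamp_itv s T0).
  - apply: (continuous_along f_cont); first by move=> x; exact: cvg_id.
    exact: picard_continuous.
  - apply: (measurableT_comp _ (IH r)); apply: continuous_measurable_fun.
    apply: (@continuous_along _ f (cst r) id) => // x; first exact: cvg_cst.
    exact: cvg_id.
apply: (@measurable_fun_cvg _ _ _ _ (fun k w => picard f T (g w) k t)) => // w _.
exact: (picard_cvg T0 c0 f_cont f_lip (@g_cont w)).
Qed.

Variables (T : R) (phi : R -> R) (b : R -> R -> R) (g : Omega -> R -> R).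
Hypothesis T0 : 0 <= T.
Hypothesis phi_cont : {within `[0, T], continuous phi}.
Hypothesis A1 : drift_continuous T phi b.
Hypothesis A2 : drift_lipschitz T phi b.
Hypothesis g_cont : forall w, continuous (g w).
Hypothesis mg : forall t, measurable_fun [set: Omega] (fun w => g w t).

Lemma measurable_approx n t :
  measurable_fun [set: Omega] (fun w => approx T phi b (g w) n t).
Proof.
have [c c0 cP] := regular_drift_lipschitz T0 A2 n.
exact: (measurable_volterra _ T0 c0 (regular_drift_continuous T0 phi_cont A1 (n := n)) cP).
Qed.

(** By continuity of the paths, survival up to [t] only has to be tested at
    countably many times, which makes it an event. *)
Lemma alive_rat w n t : 0 <= t <= T -> alive T phi b (g w) n t <->
  forall q : rat, phi (clamp t (ratr q)) + n.+1%:R^-1 <=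
    approx T phi b (g w) n (clamp t (ratr q)).
Proof.
move=> /andP[t0 tT]; split => [al q|H s st].
  by apply: al; exact: clamp_itv.
rewrite leNgt; apply/negP => neg.
pose h x := phi (clamp t x) + n.+1%:R^-1 - approx T phi b (g w) n (clamp t x).
have hc : continuous h.
  have phit : {within `[0, t], continuous phi}.
    by apply: (continuous_subspaceW _ phi_cont); apply: subset_itv; rewrite bnd_simp.
  move=> x; apply: cvgB.
    apply: cvgD; last exact: cvg_cst.
    exact: (continuous_comp_clamp t0 phit).
  apply: (@continuous_comp _ _ _ (clamp t) (approx T phi b (g w) n)).
    exact: continuous_clamp.
  exact: (approx_continuous T0 phi_cont A1 A2 (@g_cont w)).
have hs : 0 < h s by rewrite /h clamp_id// subr_gt0.
have := hc s => /cvgrPdist_lt/(_ _ hs)/nbhs_ballP[e /= e0 eP].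
have [q /[!in_itv]/= /andP[q1 q2]] : exists q, ratr q \in `]s - e, s + e[.
  by apply: rat_in_itvoo; lra.
have /eP : ball s e (ratr q).
  by rewrite /ball/= ltr_norml; apply/andP; split; lra.
have hq : h (ratr q) <= 0 by rewrite /h subr_le0.
by move/ltr_normlP => [_]; lra.
Qed.

Lemma measurable_sol t : measurable_fun [set: Omega] (fun w => sol T phi b (g w) t).
Proof.
have tT := clamp_itv t T0.
apply: (@measurable_fun_cvg _ _ _ _ (fun n w => stopped T phi b (g w) n t)).
  move=> n; apply: measurable_fun_ifT; last exact: measurable_cst.
    apply: (measurable_fun_bool true); rewrite setTI.
    rewrite (_ : _ @^-1` _ = ~` \bigcup_(q : rat) ~` [set w |
      phi (clamp (clamp T t) (ratr q)) + n.+1%:R^-1 <=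
      approx T phi b (g w) n (clamp (clamp T t) (ratr q))]).
      apply: measurableC; apply: bigcupT_measurable_rat => q; apply: measurableC.
      set s := clamp _ (ratr q); set a := phi s + _.
      have := measurable_approx n s measurableT (measurable_itv `[a, +oo[).
      rewrite setTI; congr measurable; apply/seteqP.
      by split => w /=; rewrite in_itv/= andbT.
    rewrite setC_bigcup; apply/seteqP; split => w /=.
      move/asboolP => /(alive_rat w n tT).1 H q _.
      by rewrite setCK; exact: H.
    move=> H; apply/asboolP; apply/(alive_rat w n tT) => q.
    by have := H q I; rewrite setCK.
  exact: measurable_approx.
move=> w _; exact: (stopped_cvg T0 phi_cont A1 A2 (@g_cont w)).
Qed.

End Measurability.

Theorem theorem2p2 (R : realType) (d : measure_display)
    (Omega : measurableType d) (P : probability Omega R)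
    (T lambda : R) (T_gt0 : 0 < T) (lambda01 : 0 < lambda < 1)
    (phi : R -> R) (phi_holder : exists C : R, holder_on T lambda C phi)
    (Y0 : R) (Y0_gt : phi 0 < Y0)
    (Z : R -> {RV P >-> R}) (Z_noise : holder_noise T lambda Z)
    (b : R -> R -> R)
    (A1 : drift_continuous T phi b)
    (A2 : drift_lipschitz T phi b)
    (A3 : drift_repulsive T phi b) :
  exists Y : R -> {RV P >-> R},
    [/\ continuous_process T Y,
        {ae P, forall w,
           let z := fun t => Z t w in
           let y := fun t => Y t w in
           let tau0 := exit_time T phi y in
           (forall t : R, 0 <= t <= tau0 -> equation_at b Y0 z y t) /\
           tau0%:E = Order.min (hitting_time T phi y) T%:E} &
        forall Y' : R -> {RV P >-> R}, continuous_process T Y' ->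
        {ae P, forall w,
           let z := fun t => Z t w in
           let y := fun t => Y t w in
           let y' := fun t => Y' t w in
           let tau0 := exit_time T phi y in
           let tau0' := exit_time T phi y' in
           y' 0 = Y0 ->
           (forall t : R, 0 <= t < tau0' -> equation_at b Y0 z y' t) ->
           tau0 = tau0' /\ (forall t : R, 0 <= t <= tau0 -> y' t = y t)}].
Proof.
have T0 := ltW T_gt0; have /andP[lambda0 _] := lambda01.
have [C phiC] := phi_holder.
have phi_cont := holder_continuous lambda0 phiC.
have [Z00 [Lambda LambdaP]] := Z_noise.
have Zc w : {within `[0, T], continuous (fun t => Z t w)}.
  by have [_] := LambdaP w; exact: holder_continuous.
pose g (w : Omega) t := Y0 + (Z (clamp T t) w - Z 0 w).
have g_cont w : continuous (g w).
  move=> t; apply: cvgD; first exact: cvg_cst.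
  apply: cvgB; last exact: cvg_cst.
  exact: (continuous_comp_clamp T0 (Zc w)).
have mg t : measurable_fun [set: Omega] (fun w => g w t).
  by apply: measurable_funD => //; apply: measurable_funB.
have g0 w : g w 0 = Y0 by rewrite /g clamp_id ?lexx// subrr addr0.
have g_gt0 w : phi 0 < g w 0 by rewrite g0.
have msol t := measurable_sol T0 phi_cont A1 A2 g_cont mg t.
pose Y t : {RV P >-> R} := mfun_Sub (mem_set (msol t)).
have YE w : (fun t => Y t w) = sol T phi b (g w) by apply/funext.
have equationE w y t : Z 0 w = 0 -> 0 <= t <= T ->
    equation_at b Y0 (fun t => Z t w) y t <-> solves b (g w) y t.
  move=> Z0w tT; rewrite /equation_at /solves /g clamp_id// Z0w subr0.
  by rewrite addrAC.
exists Y; split.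
- by move=> w; rewrite YE; exact: sol_continuous.
- move: Z00; apply: filterS => w Z0w; rewrite YE.
  have [/andP[tau_gt0 tauT] _ _ _] :=
    sol_exit_timeP T0 phi_cont A1 A2 (@g_cont w) A3 (g_gt0 w) T_gt0.
  split.
    move=> t tt; apply/equationE => //.
      by case/andP: tt => -> /le_trans; exact.
    exact: sol_solves_until_exit.
  apply: exit_time_hitting => //; first exact: sol_continuous.
  by rewrite (sol_start T0 phi_cont A1 A2).
- move=> Y' Y'c; move: Z00; apply: filterS => w Z0w Y'0 Y'eq.
  rewrite YE; apply: (sol_unique T0 phi_cont A1 A2 (@g_cont w) A3) => //.
  + by rewrite g0.
  + move=> t tt; apply/equationE => //; last exact: Y'eq.
    have Y'_gt : phi 0 < Y' 0 w by rewrite Y'0.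
    have [/andP[_ tauT] _ _ _] := exit_timeP T_gt0 phi_cont (Y'c w) Y'_gt.
    by case/andP: tt => -> /ltW /le_trans; exact.
Qed.
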